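(* Let $A\in\mathbb{R}^{n\times n}$ be neutrally stable and let $B\in\mathbb{R}^{n\times m}$ be such that the pair $(A,B)$ is stabilizable. Let $K\in\mathbb{R}^{m\times n}$ be any matrix constructed from $A$ and $B$ by the following procedure. Let $n_1\le n$ be the number of eigenvalues of $A$ (counted with multiplicity) on the imaginary axis and $n_2:=n-n_1$. If $n_1=0$, let $K:=0$. Otherwise: Step 1: choose $U\in\mathbb{R}^{n\times n_1}$ and $W\in\mathbb{R}^{n\times n_2}$ with $[U\ W]$ invertible and $$[U\ W]^{-1}A[U\ W]=\begin{bmatrix}F & 0 \\ 0 & G\end{bmatrix},$$ where all the eigenvalues of $F\in\mathbb{R}^{n_1\times n_1}$ have zero real parts, and let $U^\dagger\in\mathbb{R}^{n_1\times n}$ and $W^\dagger\in\mathbb{R}^{n_2\times n}$ be such that $$\begin{bmatrix} U^\dagger \\ {W^\dagger} \end{bmatrix}=[U\ W]^{-1}.$$ Step 2: let $P:=\lim_{t\to\infty}t^{-1}\int_0^t e^{F^T\tau}e^{F\tau}\,d\tau\in\mathbb{R}^{n_1\times n_1}$. Step 3: let $K:=(U^\dagger B)^TPU^\dagger$. Then for every $p\ge 1$ and every connected matrix $\Gamma=[\gamma_{ij}]\in\mathbb{R}^{p\times p}$, with $r\in\mathbb{R}^p$ such that $r^T\Gamma=0$ and $r^T\mathbf{1}=1$, for all initial conditions $x_1(0),\dots,x_p(0)\in\mathbb{R}^n$, the solutions $x_i(\cdot)$, $i=1,\dots,p$, of the coupled systems $$\dot x_i=Ax_i+Bu_i,\qquad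 u_i=Kz_i,\qquad z_i=\sum_{j=1}^p\gamma_{ij}(x_j-x_i),\qquad i=1,\dots,p,$$ synchronize to $$\bar x(t):=(r^T\otimes e^{At})\begin{bmatrix}x_1(0)\\ \vdots\\ x_p(0)\end{bmatrix}.$$
   Context: $\mathbf{1}\in\mathbb{R}^p$ is the vector of all ones; $\otimes$ is the Kronecker product; $|\cdot|$ is the 2-norm. A matrix $A\in\mathbb{R}^{n\times n}$ is neutrally stable if it has no eigenvalue with positive real part and every Jordan block corresponding to an eigenvalue on the imaginary axis has size one. A pair $(C,A)$, with $C\in\mathbb{R}^{m\times n}$ and $A\in\mathbb{R}^{n\times n}$, is detectable if, whenever $x\in\mathbb{R}^n$ satisfies $Ce^{At}x=0$ for all $t\ge0$, one has $\lim_{t\to\infty}e^{At}x=0$. The pair $(A,B)$ is stabilizable if $(B^T,A^T)$ is detectable. The graph of a matrix $\Gamma=[\gamma_{ij}]\in\mathbb{R}^{p\times p}$ is the directed graph with nodes $n_1,\dots,n_p$ and an arc $(n_i,n_j)$ (from $n_i$ to $n_j$) iff $\gamma_{ij}>0$. A directed graph is connected if it has a node to which there is a (directed) path from every other node. The matrix $\Gamma$ is connected if (i) $\gamma_{ij}\ge0$ for $i\ne j$; (ii) each row sum equals $0$; (iii) its graph is connected. For connected $\Gamma$, the vector $r$ with $r^T\Gamma=0$, $r^T\mathbf{1}=1$ exists and is unique. In the construction, the limit defining $P$ exists. When $n_2=0$, the blocks $W$, $W^\dagger$ and $G$ are absent. Maps $\xi_i:\mathbb{R}_{\ge0}\to\mathbb{R}^n$,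 $i=1,\dots,p$, synchronize to $\bar\xi:\mathbb{R}_{\ge0}\to\mathbb{R}^n$ if $|\xi_i(t)-\bar\xi(t)|\to0$ as $t\to\infty$ for all $i$. *)

(* Defs.v *)
From HB Require Import structures.
From mathcomp Require Import all_boot all_order all_algebra.
From mathcomp Require Import complex mxtens.
From mathcomp Require Import all_classical all_reals all_analysis.

Set Implicit Arguments.
Unset Strict Implicit.
Unset Printing Implicit Defensive.

Import Order.TTheory GRing.Theory Num.Theory.
Import numFieldNormedType.Exports.

Local Open Scope classical_set_scope.
Local Open Scope ring_scope.

Definition norm2 (R : realType) (n : nat) (v : 'cV[R]_n) : R :=
  Num.sqrt (\sum_(i < n) v i ord0 ^+ 2).

Definition expmx (R : realType) (n : nat) (M : 'M[R]_n) : 'M[R]_n :=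
  limn (series (fun k : nat => (k`!%:R)^-1 *: M ^+ k)).

Definition complexify (R : realType) (n : nat) (A : 'M[R]_n) : 'M[R[i]]_n :=
  map_mx (real_complex R) A.

(* The eigenvalues of A in R[i], repeated according to algebraic multiplicity:
   the roots of the (split, monic) characteristic polynomial. *)
Definition spectrum (R : realType) (n : nat) (A : 'M[R]_n) : seq R[i] :=
  sval (closed_field_poly_normal (char_poly (complexify A))).

Definition imag_eig_count (R : realType) (n : nat) (A : 'M[R]_n) : nat :=
  count (fun z : R[i] => complex.Re z == 0) (spectrum A).

Definition jordan_block (C : nzRingType) (k : nat) (z : C) : 'M[C]_k :=
  \matrix_(i < k, j < k) (z *+ (i == j) + (i.+1 == j :> nat)%:R).

(* The size [\sum_(i < k) d i] of the block-diagonal matrix is only propositionally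
   equal to n, so the change of basis is a pair of mutually inverse,
   a priori rectangular, matrices. *)
Definition is_jordan_form (C : fieldType) (n : nat) (M : 'M[C]_n)
    (k : nat) (d : 'I_k -> nat) (z : 'I_k -> C) : Prop :=
  (forall i, (0 < d i)%N) /\
  exists (S : 'M[C]_(n, \sum_(i < k) d i)) (T : 'M[C]_(\sum_(i < k) d i, n)),
    [/\ S *m T = 1%:M, T *m S = 1%:M &
        T *m M *m S = \mxdiag_(i < k) jordan_block (d i) (z i)].

(* A Jordan form exists and is unique up to the order of its blocks, hence it
   does not matter which one is inspected. *)
Definition neutrally_stable (R : realType) (n : nat) (A : 'M[R]_n) : Prop :=
  (forall z : R[i], eigenvalue (complexify A) z -> ~ (0 < complex.Re z)) /\
  exists (k : nat) (d : 'I_k -> nat) (z : 'I_k -> R[i]),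
    is_jordan_form (complexify A) d z /\
    (forall i, complex.Re (z i) = 0 -> d i = 1%N).

Definition detectable (R : realType) (m n : nat)
    (C : 'M[R]_(m, n)) (A : 'M[R]_n) : Prop :=
  forall x : 'cV[R]_n,
    (forall t : R, 0 <= t -> C *m expmx (t *: A) *m x = 0) ->
    expmx (t *: A) *m x @[t --> +oo] --> (0 : 'cV[R]_n).

Definition stabilizable (R : realType) (m n : nat)
    (A : 'M[R]_n) (B : 'M[R]_(n, m)) : Prop :=
  detectable B^T A^T.

Definition arc (R : realType) (p : nat) (Gamma : 'M[R]_p) : rel 'I_p :=
  fun i j => 0 < Gamma i j.

Definition connected_graph (T : finType) (e : rel T) : Prop :=
  exists v : T, forall w : T, w != v -> connect e w v.

Definition connected_mx (R : realType) (p : nat) (Gamma : 'M[R]_p) : Prop :=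
  [/\ forall i j, i != j -> 0 <= Gamma i j,
      forall i, \sum_(j < p) Gamma i j = 0 &
      connected_graph (arc Gamma)].

Definition mean_gram (R : realType) (n : nat) (F : 'M[R]_n) (t : R) : 'M[R]_n :=
  t^-1 *: \matrix_(i < n, j < n)
    \int[lebesgue_measure]_(tau in `[0, t])
      (expmx (tau *: F^T) *m expmx (tau *: F)) i j.

(* The inverse of [U W] is the block column (Ud, Wd): the type of [U W] is
   'M_(n, n1 + n2), where n1 + n2 = n is not a conversion, so both products are
   required to be the identity. *)
Definition is_gain (R : realType) (m n : nat) (A : 'M[R]_n) (B : 'M[R]_(n, m))
    (K : 'M[R]_(m, n)) : Prop :=
  let n1 := imag_eig_count A in
  let n2 := (n - n1)%N in
  if n1 == 0%N then K = 0 else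
  exists (U : 'M[R]_(n, n1)) (W : 'M[R]_(n, n2))
         (Ud : 'M[R]_(n1, n)) (Wd : 'M[R]_(n2, n))
         (F : 'M[R]_n1) (G : 'M[R]_n2) (P : 'M[R]_n1),
    [/\ row_mx U W *m col_mx Ud Wd = 1%:M /\
        col_mx Ud Wd *m row_mx U W = 1%:M,
        col_mx Ud Wd *m A *m row_mx U W = block_mx F 0 0 G,
        forall z : R[i], eigenvalue (complexify F) z -> complex.Re z = 0,
        mean_gram F t @[t --> +oo] --> P &
        K = (Ud *m B)^T *m P *m Ud].

Definition coupling (R : realType) (n p : nat) (Gamma : 'M[R]_p)
    (x : 'I_p -> 'cV[R]_n) (i : 'I_p) : 'cV[R]_n :=
  \sum_(j < p) Gamma i j *: (x j - x i).

(* A solution on [0, +oo[ is continuous there and satisfies the differential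
   equation for t > 0; the values of x at negative times are irrelevant. *)
Definition is_solution (R : realType) (m n p : nat) (A : 'M[R]_n)
    (B : 'M[R]_(n, m)) (K : 'M[R]_(m, n)) (Gamma : 'M[R]_p)
    (x0 : 'I_p -> 'cV[R]_n) (x : 'I_p -> R -> 'cV[R]_n) : Prop :=
  forall i : 'I_p,
    [/\ x i 0 = x0 i,
        {within `[0, +oo[, continuous (x i)} &
        forall t : R, 0 < t ->
          is_derive t 1 (x i)
            (A *m x i t + B *m (K *m coupling Gamma (x ^~ t) i))].

Definition stack (R : realType) (n p : nat) (x : 'I_p -> 'cV[R]_n) :
    'cV[R]_(p * n) :=
  \col_(k < p * n) x (mxtens_unindex k).1 (mxtens_unindex k).2 ord0.

Definition sync_trajectory (R : realType) (n p : nat) (A : 'M[R]_n)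
    (r : 'cV[R]_p) (x0 : 'I_p -> 'cV[R]_n) (t : R) : 'cV[R]_n :=
  castmx (mul1n n, erefl) ((r^T *t expmx (t *: A)) *m stack x0).

Definition synchronize (R : realType) (n p : nat)
    (xi : 'I_p -> R -> 'cV[R]_n) (xibar : R -> 'cV[R]_n) : Prop :=
  forall i : 'I_p, norm2 (xi i t - xibar t) @[t --> +oo] --> (0 : R).

(* Main.v *)
Require Import Defs.
From HB Require Import structures.
From mathcomp Require Import all_boot all_order all_algebra.
From mathcomp Require Import complex mxtens.
From mathcomp Require Import all_classical all_reals all_analysis.
From mathcomp Require Import ring lra.
Import Order.TTheory GRing.Theory Num.Theory.
Import numFieldNormedType.Exports.
Local Open Scope classical_set_scope.
Local Open Scope ring_scope.

(* Let X be the n x p matrix of states and E := X (1 - r 1^T) the matrix of the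
   deviations x_i - sum_j r_j x_j.  The weighted mean solves s' = A s, and
   E' = A E + B K E (Gamma - 1 r^T)^T.  Every eigenvalue l of Gamma - 1 r^T has
   negative real part, by a maximum principle along the arcs, so it suffices that
   A + l B K be Hurwitz: E is then annihilated by a product of factors of the
   characteristic polynomials, which are peeled off one at a time, each leaving
   a scalar equation y' = z y + f with Re z < 0 and f -> 0.

   For A + l B K the averaged Gramian P is symmetric, positive semidefinite and
   satisfies F^T P + P F = 0.  Let a be the F-component of an eigenvector for mu,
   Bu := U^dagger B and a <> 0.  Pairing with a^* P gives
   Re l |Bu^T P a|^2 = Re mu (a^* P a), so Re mu >= 0 forces Bu^T P a = 0 and
   F a = mu a.  As |e^{Ft} a| is constant, a^* P a = |a|^2 <> 0, and P a yields
   an undamped mode of A^T invisible through B^T, contradicting stabilizability.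
   If a = 0, then mu is an eigenvalue of G. *)

Set Implicit Arguments.
Unset Strict Implicit.
Unset Printing Implicit Defensive.

(** * Decay of scalar differential inequalities *)

Lemma is_derive_congr (R : realType) (f g : R -> R) (t df dg : R) :
  is_derive t 1 f df -> f =1 g -> df = dg -> is_derive t 1 g dg.
Proof. by move=> d /funext <- <-. Qed.

Lemma MVT_gt0 (R : realType) (f df : R -> R) (x y : R) :
  0 < x -> x <= y -> (forall t : R, 0 < t -> is_derive t 1 f (df t)) ->
  exists2 c, x <= c <= y & f y - f x = df c * (y - x).
Proof.
move=> x0 xy fd.
have [||c cxy fE] := @MVT_segment R f df x y xy.
- by move=> t; rewrite in_itv/= => /andP[xt _]; apply: fd; lra.
- apply: derivable_within_continuous => t; rewrite in_itv/= => /andP[xt _].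
  have t0 : 0 < t by lra.
  by have [] := fd t t0.
- by exists c => //; move: cxy; rewrite in_itv.
Qed.

Lemma ler0_is_derive_nincr (R : realType) (f df : R -> R) (x y : R) :
  0 < x -> x <= y -> (forall t : R, 0 < t -> is_derive t 1 f (df t)) ->
  (forall t, x <= t -> t <= y -> df t <= 0) -> f y <= f x.
Proof.
move=> x0 xy fd d0; have [c /andP[xc cy] fE] := MVT_gt0 x0 xy fd.
by rewrite -subr_le0 fE mulr_le0_ge0 ?subr_ge0// d0.
Qed.

(** Once the forcing is below [a * (e / 2)], the integrating factor makes
    [(v - e / 2) * expR (a * t)] nonincreasing, and its value at a fixed time is outgrown by the
    exponential. *)
Lemma cvg0_of_decay (R : realType) (a : R) (v dv g : R -> R) : 0 < a ->
  (forall t : R, 0 < t -> is_derive t 1 v (dv t)) -> (forall t, 0 <= v t) ->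
  (forall t : R, 0 < t -> dv t <= - a * v t + g t) ->
  g t @[t --> +oo] --> (0 : R) -> v t @[t --> +oo] --> (0 : R).
Proof.
move=> a0 vd v0 dvle /cvgrPdist_le g0; apply/cvgrPdist_le => e e0.
have [T [_ gT]] := g0 (a * (e / 2)) ltac:(by rewrite mulr_gt0// divr_gt0).
pose T1 := Num.max T 0 + 1.
have T10 : 0 < T1 by rewrite ltr_wpDl// le_max lexx orbT.
have TT1 : T < T1 by rewrite ltr_pwDr// le_max lexx.
pose w t := (v t - e / 2) * expR (a * t).
pose dw t := (dv t) * expR (a * t) + (v t - e / 2) * (a * expR (a * t)).
have wd (t : R) : 0 < t -> is_derive t 1 w (dw t).
  move=> t0; have vdt := vd t t0.
  have ed : is_derive t 1 (fun s => expR (a * s)) (a * expR (a * t)).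
    have -> : (fun s => expR (a * s)) = expR \o (a \*: (@id R)) by apply/funext => s.
    by apply: is_derive_eq; rewrite /GRing.scale/= mulr1 mulrC.
  apply: is_derive_congr
    (is_deriveM (is_deriveB vdt (is_derive_cst (e / 2) t 1)) ed) _ _ => //.
  by rewrite /dw subr0 !fctE /GRing.scale/=; ring.
near=> t.
have tT1 : T1 <= t by near: t; apply: nbhs_pinfty_ge; exact: num_real.
(* With [expR_ge1Dx], this threshold makes [e / 2 * expR (a * t)] dominate [w T1], whence
   [v t <= e]. *)
have tw : `|w T1| * 2 / (e * a) <= t by near: t; apply: nbhs_pinfty_ge; exact: num_real.
have wle : w t <= w T1.
  apply: (ler0_is_derive_nincr T10 tT1 wd) => s T1s st.
  have s0 : 0 < s by lra.
  have -> : dw s = (dv s + a * (v s - e / 2)) * expR (a * s) by rewrite /dw; ring.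
  rewrite mulr_le0_ge0 ?expR_ge0//.
  have := gT s ltac:(by apply: lt_le_trans T1s).
  rewrite /= sub0r normrN => /(le_trans (ler_norm _)).
  have := dvle s s0; nra.
rewrite sub0r normrN ger0_norm//.
have t0 : 0 < t by lra.
have E := expR_ge1Dx (a * t).
have E0 := expR_gt0 (a * t).
have wb : w T1 <= e / 2 * (a * t).
  apply: le_trans (ler_norm _) _.
  have -> : e / 2 * (a * t) = t * (e * a) / 2 by ring.
  by rewrite ler_pdivlMr// -ler_pdivrMr ?mulr_gt0.
have : (v t - e / 2) * expR (a * t) <= e / 2 * expR (a * t).
  apply: le_trans wle _; apply: le_trans wb _.
  by rewrite ler_pM2l ?divr_gt0//; lra.
by rewrite ler_pM2r//; lra.
Unshelve. all: by end_near. Qed.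

(* Complex-valued functions of a real variable are differentiated through their
   real and imaginary parts, R[i] being a normed space over itself only. *)
Lemma cvg0_of_complex_decay (R : realType) (r : R[i]) (y1 y2 f1 f2 : R -> R) :
  complex.Re r < 0 ->
  (forall t : R, 0 < t ->
     is_derive t 1 y1 (complex.Re r * y1 t - complex.Im r * y2 t + f1 t)) ->
  (forall t : R, 0 < t ->
     is_derive t 1 y2 (complex.Re r * y2 t + complex.Im r * y1 t + f2 t)) ->
  f1 t @[t --> +oo] --> (0 : R) -> f2 t @[t --> +oo] --> (0 : R) ->
  y1 t @[t --> +oo] --> (0 : R) /\ y2 t @[t --> +oo] --> (0 : R).
Proof.
case: r => a b /= a0 d1 d2 f10 f20.
pose v t := y1 t ^+ 2 + y2 t ^+ 2.
pose dv t := 2 * (y1 t * (a * y1 t - b * y2 t + f1 t)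
                 + y2 t * (a * y2 t + b * y1 t + f2 t)).
(* Half of the decay [2 a |y|^2] is spent on the cross term [2 y.f], at the price of the forcing
   [|f|^2 / (- a)]; what remains is the square [|a y + f|^2 / (- a)]. *)
pose g t := (f1 t ^+ 2 + f2 t ^+ 2) * (- a)^-1.
have v0 : v t @[t --> +oo] --> (0 : R).
  apply: (@cvg0_of_decay _ (- a) v dv g).
  - by rewrite oppr_gt0.
  - move=> t t0; have D1 := d1 t t0; have D2 := d2 t t0.
    apply: is_derive_congr (is_deriveD (is_deriveX 2 D1) (is_deriveX 2 D2)) _ _ => //.
    rewrite /dv !expr1 /GRing.scale/=; ring.
  - by move=> t; rewrite addr_ge0 ?sqr_ge0.
  - move=> t t0; rewrite /dv /g /v.
    have an : a != 0 by lra.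
    rewrite -subr_ge0.
    have -> : - - a * (y1 t ^+ 2 + y2 t ^+ 2) + (f1 t ^+ 2 + f2 t ^+ 2) / - a -
      2 * (y1 t * (a * y1 t - b * y2 t + f1 t) +
           y2 t * (a * y2 t + b * y1 t + f2 t)) =
      ((a * y1 t + f1 t) ^+ 2 + (a * y2 t + f2 t) ^+ 2) / - a by field.
    by rewrite divr_ge0 ?addr_ge0 ?sqr_ge0//; lra.
  - have -> : (0 : R) = (0 ^+ 2 + 0 ^+ 2) * (- a)^-1 by rewrite expr0n/= addr0 mul0r.
    by apply: cvgM; [apply: cvgD; apply: cvgM|exact: cvg_cst].
have key (y : R -> R) : (forall t, y t ^+ 2 <= v t) -> y t @[t --> +oo] --> (0 : R).
  move=> yv; apply/cvgrPdist_le => e e0.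
  move/cvgrPdist_le : v0 => /(_ (e ^+ 2) ltac:(by rewrite exprn_gt0)).
  apply: filterS => t; rewrite !sub0r !normrN => vt.
  rewrite -(@ler_pXn2r _ 2%N) ?nnegrE ?normr_ge0 ?(ltW e0)//.
  rewrite real_normK ?num_real//.
  exact: le_trans (yv t) (le_trans (ler_norm _) vt).
by split; apply: key => t; rewrite /v ?lerDl ?lerDr sqr_ge0.
Qed.

(** * Matrix calculus and the matrix exponential *)

Lemma cvg_mxP (R : realType) (T : Type) (F : set_system T) (m n : nat)
    (X : T -> 'M[R]_(m, n)) (L : 'M[R]_(m, n)) {FF : Filter F} :
  X s @[s --> F] --> L <-> forall i j, X s i j @[s --> F] --> L i j.
Proof.
split=> [XL i j|XL].
  exact: (cvg_comp (fun s => X s) (fun M : 'M[R]_(m, n) => M i j) XL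
            (@coord_continuous _ _ _ i j L)).
apply/cvgrPdist_le => e e0.
have : \forall s \near F, forall ij : 'I_m * 'I_n, `|L ij.1 ij.2 - X s ij.1 ij.2| <= e.
  apply: filter_forall => -[i j] /=.
  by have /cvgrPdist_le := XL i j; apply.
apply: filterS => s H; rewrite /Num.Def.normr/= mx_normrE.
by rewrite (bigmax_le _ (ltW e0))//= => ij _; rewrite !mxE.
Qed.

Lemma cvg_mulmx (R : realType) (T : Type) (F : set_system T) (m n p : nat)
    (X : T -> 'M[R]_(m, n)) (Y : T -> 'M[R]_(n, p)) (L : 'M[R]_(m, n))
    (M : 'M[R]_(n, p)) {FF : Filter F} :
  X s @[s --> F] --> L -> Y s @[s --> F] --> M ->
  (X s *m Y s) @[s --> F] --> (L *m M).
Proof.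
move=> /cvg_mxP XL /cvg_mxP YM; apply/cvg_mxP => i j.
rewrite mxE; under eq_fun do rewrite mxE.
apply: cvg_big => [|k _]; first exact: add_continuous.
by apply: cvgM; [exact: XL|exact: YM].
Qed.

Lemma cvg_mulmxl (R : realType) (T : Type) (F : set_system T) (m n p : nat)
    (A : 'M[R]_(p, m)) (X : T -> 'M[R]_(m, n)) (L : 'M[R]_(m, n)) {FF : Filter F} :
  X s @[s --> F] --> L -> (A *m X s) @[s --> F] --> (A *m L).
Proof. by move=> XL; apply: cvg_mulmx XL; exact: cvg_cst. Qed.

Lemma cvg_mulmxr (R : realType) (T : Type) (F : set_system T) (m n p : nat)
    (A : 'M[R]_(n, p)) (X : T -> 'M[R]_(m, n)) (L : 'M[R]_(m, n)) {FF : Filter F} :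
  X s @[s --> F] --> L -> (X s *m A) @[s --> F] --> (L *m A).
Proof. by move=> XL; apply: (cvg_mulmx XL); exact: cvg_cst. Qed.

Lemma cvg_trmx (R : realType) (T : Type) (F : set_system T) (m n : nat)
    (X : T -> 'M[R]_(m, n)) (L : 'M[R]_(m, n)) {FF : Filter F} :
  X s @[s --> F] --> L -> ((X s)^T) @[s --> F] --> L^T.
Proof.
move=> /cvg_mxP XL; apply/cvg_mxP => i j.
by rewrite mxE; under eq_fun do rewrite mxE; exact: XL.
Qed.

(** Kept entrywise so that product rules and power series reduce to scalar calculus. *)
Definition is_mx_derive (R : realType) (m n : nat) (X : R -> 'M[R]_(m, n))
    (t : R) (D : 'M[R]_(m, n)) : Prop :=
  forall i j, is_derive t 1 (fun s => X s i j) (D i j).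

Lemma is_derive_mx (R : realType) (m n : nat) (X : R -> 'M[R]_(m, n))
    (t : R) (D : 'M[R]_(m, n)) :
  is_derive t 1 X D -> is_mx_derive X t D.
Proof.
move=> [Xt <-] i j; apply: DeriveDef; first by move/derivable_mxP : Xt => /(_ i j).
by rewrite derive_mx// mxE.
Qed.

Lemma is_mx_derive_cst (R : realType) (m n : nat) (A : 'M[R]_(m, n)) (t : R) :
  is_mx_derive (fun=> A) t 0.
Proof. by move=> i j; rewrite mxE; exact: is_derive_cst. Qed.

Lemma is_mx_deriveD (R : realType) (m n : nat) (X Y : R -> 'M[R]_(m, n)) (t : R) DX DY :
  is_mx_derive X t DX -> is_mx_derive Y t DY ->
  is_mx_derive (fun s => X s + Y s) t (DX + DY).
Proof.
move=> dX dY i j.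
apply: is_derive_congr (is_deriveD (dX i j) (dY i j)) _ _; last by rewrite mxE.
by move=> s; rewrite mxE.
Qed.

Lemma is_mx_deriveN (R : realType) (m n : nat) (X : R -> 'M[R]_(m, n)) (t : R) DX :
  is_mx_derive X t DX -> is_mx_derive (fun s => - X s) t (- DX).
Proof.
move=> dX i j.
apply: is_derive_congr (is_deriveN (dX i j)) _ _; last by rewrite mxE.
by move=> s; rewrite mxE.
Qed.

Lemma is_mx_deriveM (R : realType) (m n p : nat) (X : R -> 'M[R]_(m, n))
    (Y : R -> 'M[R]_(n, p)) (t : R) DX DY :
  is_mx_derive X t DX -> is_mx_derive Y t DY ->
  is_mx_derive (fun s => X s *m Y s) t (DX *m Y t + X t *m DY).
Proof.
move=> dX dY i j.
have h k : is_derive t 1 ((fun s => X s i k) * (fun s => Y s k j))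
  (X t i k *: DY k j + Y t k j *: DX i k) by exact: is_deriveM.
apply: is_derive_congr (is_derive_sum h) _ _ => [s|].
  by rewrite mxE fct_sumE; apply: eq_bigr.
rewrite !mxE -big_split/=; apply: eq_bigr => k _.
by rewrite /GRing.scale/=; ring.
Qed.

Lemma is_mx_derive_eq (R : realType) (m n : nat) (X : R -> 'M[R]_(m, n)) (t : R) DX DY :
  is_mx_derive X t DX -> DX = DY -> is_mx_derive X t DY.
Proof. by move=> d <-. Qed.

Lemma is_mx_derive_mulmxl (R : realType) (m n p : nat) (A : 'M[R]_(p, m))
    (X : R -> 'M[R]_(m, n)) (t : R) DX :
  is_mx_derive X t DX -> is_mx_derive (fun s => A *m X s) t (A *m DX).
Proof.
move=> d; apply: is_mx_derive_eq (is_mx_deriveM (is_mx_derive_cst A t) d) _.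
by rewrite mul0mx add0r.
Qed.

Lemma is_mx_derive_mulmxr (R : realType) (m n p : nat) (A : 'M[R]_(n, p))
    (X : R -> 'M[R]_(m, n)) (t : R) DX :
  is_mx_derive X t DX -> is_mx_derive (fun s => X s *m A) t (DX *m A).
Proof.
move=> d; apply: is_mx_derive_eq (is_mx_deriveM d (is_mx_derive_cst A t)) _.
by rewrite mulmx0 addr0.
Qed.

Lemma is_mx_derive_tr (R : realType) (m n : nat) (X : R -> 'M[R]_(m, n)) (t : R) DX :
  is_mx_derive X t DX -> is_mx_derive (fun s => (X s)^T) t DX^T.
Proof.
move=> d i j; rewrite mxE; apply: is_derive_congr (d j i) _ _ => //.
by move=> s; rewrite mxE.
Qed.

Lemma is_mx_derive0_cst (R : realType) (m n : nat) (X : R -> 'M[R]_(m, n)) :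
  (forall t, is_mx_derive X t 0) -> forall s t, X s = X t.
Proof.
move=> d s t; apply/matrixP => i j.
apply: (@is_derive_0_is_cst _ (fun s => X s i j)) => u.
by have := d u i j; rewrite mxE.
Qed.

(** The sum of the moduli of all entries dominates every row sum, which is what one more factor [A]
    costs. The geometric bound majorises the exponential series by a scalar one. *)
Lemma exprmx_entry_bound (R : realType) (n : nat) (A : 'M[R]_n) :
  exists2 c : R, 0 <= c & forall k i j, `|(A ^+ k) i j| <= c ^+ k.
Proof.
exists (\sum_i \sum_j `|A i j|); first by apply: sumr_ge0 => i _; apply: sumr_ge0.
elim=> [|k IH] i j.
  by rewrite expr0 mxE; case: (i == j); rewrite ?normr1 ?normr0.
rewrite exprS mxE exprS.
apply: le_trans (ler_norm_sum _ _ _) _.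
apply: (@le_trans _ _ ((\sum_l `|A i l|) * (\sum_i \sum_j `|A i j|) ^+ k)).
  by rewrite mulr_suml; apply: ler_sum => l _; rewrite normrM ler_wpM2l.
rewrite ler_wpM2r//; last first.
  by rewrite [leRHS](bigD1 i)//= lerDl sumr_ge0// => l _; rewrite sumr_ge0.
by rewrite exprn_ge0// sumr_ge0// => l _; rewrite sumr_ge0.
Qed.

Lemma exprmxZ (R : comPzRingType) (n : nat) (t : R) (A : 'M[R]_n) (k : nat) :
  (t *: A) ^+ k = t ^+ k *: A ^+ k.
Proof.
elim: k => [|k IH]; first by rewrite !expr0 scale1r.
by rewrite !exprS IH -![_ * _]/(_ *m _) -scalemxAl -scalemxAr scalerA.
Qed.

(** * The exponential through the power series of its entries *)

Section MatrixExponential.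
Context (R : realType) (n : nat).
Implicit Types (A : 'M[R]_n) (t : R).

(** Taylor coefficients of the entries of [A ^+ l *m expmx (t *: A)]. Formal differentiation raises
    the shift [l] by one, so a single convergence proof serves all derivatives. *)
Let coef A (l : nat) (i j : 'I_n) (k : nat) : R := (A ^+ (k + l)) i j / k`!%:R.

Let coef_cvg A l i j t : cvgn (pseries (coef A l i j) t).
Proof.
have [c c0 Ac] := exprmx_entry_bound A.
apply: normed_cvg.
apply: (@series_le_cvg _ _ (fun k => c ^+ l * exp_coeff (c * `|t|) k)).
- by move=> k; exact: normr_ge0.
- by move=> k; rewrite mulr_ge0 ?exprn_ge0// exp_coeff_ge0// mulr_ge0.
- move=> k /=; rewrite /coef !normrM normrX normfV normr_nat /exp_coeff/=.
  have -> : c ^+ l * ((c * `|t|) ^+ k / k`!%:R) = c ^+ (k + l) / k`!%:R * `|t| ^+ k.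
    by rewrite exprMn exprD; ring.
  by rewrite ler_wpM2r ?exprn_ge0// ler_wpM2r ?invr_ge0.
- by apply: is_cvg_seriesZ; exact: is_cvg_series_exp_coeff.
Qed.

Let coef_diffs A l i j : pseries_diffs (coef A l i j) = coef A l.+1 i j.
Proof.
apply/funext => k; rewrite /pseries_diffs /coef factS natrM addSnnS.
by rewrite invfM mulrCA mulVKf// pnatr_eq0.
Qed.

Let partial A t : nat -> 'M[R]_n := series (fun k => (k`!%:R)^-1 *: (t *: A) ^+ k).

Let partialE A t i j : (fun N => partial A t N i j) = pseries (coef A 0 i j) t.
Proof.
apply/funext => N; rewrite /partial /pseries /series/= summxE.
apply: eq_bigr => k _; rewrite exprmxZ /coef addn0 mxE.
by rewrite mxE; ring.
Qed.

(** [expmx] is a [limn], whose value is meaningful only once the partial sums converge; later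
    identities pass to the limit through this fact. *)
Lemma expmx_cvg A t :
  series (fun k => (k`!%:R)^-1 *: (t *: A) ^+ k) N @[N --> \oo] --> expmx (t *: A).
Proof.
rewrite -/(partial A t).
have : partial A t N @[N --> \oo] --> \matrix_(i, j) limn (pseries (coef A 0 i j) t).
  by apply/cvg_mxP => i j; rewrite mxE partialE; exact: coef_cvg.
by move=> /cvgP.
Qed.

Let expmx_entry A t i j : expmx (t *: A) i j = limn (pseries (coef A 0 i j) t).
Proof.
have /cvg_mxP/(_ i j) := @expmx_cvg A t.
by rewrite -/(partial A t) partialE => /cvg_lim <-.
Qed.

Let mul_partialE A t i j :
  (fun N => (A *m partial A t N) i j) = pseries (coef A 1 i j) t.
Proof.
apply/funext => N; rewrite /partial /pseries /series/= mulmx_sumr summxE.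
apply: eq_bigr => k _; rewrite exprmxZ /coef addn1.
by rewrite -!scalemxAr -[A *m _]/(A * _) -exprS !mxE; ring.
Qed.

Lemma expmx_derive A t :
  is_mx_derive (fun s => expmx (s *: A)) t (A *m expmx (t *: A)).
Proof.
move=> i j.
have D : is_derive t 1 (fun x => limn (pseries (coef A 0 i j) x))
    (limn (pseries (pseries_diffs (coef A 0 i j)) t)).
  (* The series converge on the whole line, so any radius beyond the modulus of [t] will do. *)
  apply: (@pseries_snd_diffs _ _ (`|t| + 1)); rewrite ?coef_diffs ?coef_cvg//.
  by rewrite [ltRHS]ger0_norm// ltrDl.
apply: is_derive_congr D _ _ => [s|]; first by rewrite expmx_entry.
rewrite coef_diffs; apply/cvg_lim => //; rewrite -mul_partialE.
have := @expmx_cvg A t; rewrite -/(partial A t).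
by move=> /(cvg_mulmxl (A := A))/cvg_mxP; apply.
Qed.

Lemma expmx_comm A t : A *m expmx (t *: A) = expmx (t *: A) *m A.
Proof.
have E := @expmx_cvg A t.
apply: (cvg_unique (@norm_hausdorff _ _) (cvg_mulmxl (A := A) E)).
rewrite (_ : (fun _ => _) = fun N => partial A t N *m A); first exact: cvg_mulmxr.
apply/funext => N; rewrite mulmx_sumr mulmx_suml; apply: eq_bigr => k _.
rewrite -scalemxAr -scalemxAl; congr (_ *: _).
elim: k => [|k IH]; first by rewrite expr0 mulmx1 mul1mx.
by rewrite exprSr -[_ * _]/(_ *m _) mulmxA IH -!mulmxA -scalemxAl -scalemxAr.
Qed.

Lemma expmx_tr A t : expmx (t *: A^T) = (expmx (t *: A))^T.
Proof.
have E := @expmx_cvg A^T t.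
apply: (cvg_unique (@norm_hausdorff _ _) E).
rewrite (_ : (fun _ => _) = fun N => (partial A t N)^T); first by apply: cvg_trmx; exact: expmx_cvg.
apply/funext => N; rewrite raddf_sum; apply: eq_bigr => k _ /=.
rewrite linearZ /=; congr (_ *: _).
elim: k => [|k IH]; first by rewrite !expr0 trmx1.
by rewrite exprS exprSr IH -![_ * _]/(_ *m _) trmx_mul linearZ.
Qed.

Lemma expmx0 A : expmx (0 *: A) = 1%:M.
Proof.
apply: (cvg_unique (@norm_hausdorff _ _) (@expmx_cvg A 0)); apply: cvg_near_cst.
exists 1%N => // -[//|N] _.
rewrite /series/= big_nat_recl// big1_seq ?addr0.
  by rewrite expr0 fact0 invr1 scale1r.
by move=> k _; rewrite exprS scale0r mul0r scaler0.
Qed.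

Lemma expmxN_derive A t :
  is_mx_derive (fun s => expmx (s *: - A)) t (- (A *m expmx (t *: - A))).
Proof. by rewrite -mulNmx; exact: expmx_derive. Qed.

Lemma expmxV A t : expmx (t *: A) *m expmx (t *: - A) = 1%:M.
Proof.
rewrite (@is_mx_derive0_cst _ _ _ (fun s => expmx (s *: A) *m expmx (s *: - A)) _ t 0).
  by rewrite !expmx0 mulmx1.
move=> s; apply: is_mx_derive_eq.
  by apply: is_mx_deriveM; [exact: expmx_derive|exact: expmxN_derive].
by rewrite mulmxN mulmxA -expmx_comm subrr.
Qed.

(** Links a condition on powers of [A], accessible to induction, with the condition on the flow in
    [detectable]. *)
Lemma expmx_mul0 (m p : nat) (C : 'M[R]_(m, n)) A (x : 'M[R]_(n, p)) t :
  (forall k, C *m A ^+ k *m x = 0) -> C *m expmx (t *: A) *m x = 0.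
Proof.
move=> CA; apply: (cvg_unique (@norm_hausdorff _ _)
  (cvg_mulmxr (A := x) (cvg_mulmxl (A := C) (@expmx_cvg A t)))).
rewrite (_ : (fun _ => _) = fun=> 0); first exact: cvg_cst.
apply/funext => N; rewrite mulmx_sumr mulmx_suml big1_seq// => k _; rewrite exprmxZ.
by rewrite -!scalemxAr -!scalemxAl CA !scaler0.
Qed.

End MatrixExponential.

(** * Stability from complex eigenvalues *)

Section ComplexParts.
Context (R : realType).
Implicit Types x y : R[i].

Lemma complexReD x y : complex.Re (x + y) = complex.Re x + complex.Re y.
Proof. by case: x y => ? ? []. Qed.

Lemma complexImD x y : complex.Im (x + y) = complex.Im x + complex.Im y.
Proof. by case: x y => ? ? []. Qed.

Lemma complexReM x y :
  complex.Re (x * y) = complex.Re x * complex.Re y - complex.Im x * complex.Im y.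
Proof. by case: x y => ? ? []. Qed.

Lemma complexImM x y :
  complex.Im (x * y) = complex.Re x * complex.Im y + complex.Im x * complex.Re y.
Proof. by case: x y => ? ? [? ?]. Qed.

Lemma complex_eqP x y :
  complex.Re x = complex.Re y -> complex.Im x = complex.Im y -> x = y.
Proof. by case: x y => ? ? [? ?] /= -> ->. Qed.

Definition mxRe m n (A : 'M[R[i]]_(m, n)) : 'M[R]_(m, n) := map_mx (@complex.Re R) A.
Definition mxIm m n (A : 'M[R[i]]_(m, n)) : 'M[R]_(m, n) := map_mx (@complex.Im R) A.

Lemma mxReD m n (A B : 'M[R[i]]_(m, n)) : mxRe (A + B) = mxRe A + mxRe B.
Proof. by apply/matrixP => i j; rewrite !mxE complexReD. Qed.

Lemma mxImD m n (A B : 'M[R[i]]_(m, n)) : mxIm (A + B) = mxIm A + mxIm B.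
Proof. by apply/matrixP => i j; rewrite !mxE complexImD. Qed.

Lemma mxReM m n p (A : 'M[R[i]]_(m, n)) (B : 'M[R[i]]_(n, p)) :
  mxRe (A *m B) = mxRe A *m mxRe B - mxIm A *m mxIm B.
Proof.
apply/matrixP => i j; rewrite !mxE -sumrB.
rewrite (big_morph _ complexReD (erefl : complex.Re (0 : R[i]) = 0)).
by apply: eq_bigr => k _; rewrite !mxE complexReM.
Qed.

Lemma mxImM m n p (A : 'M[R[i]]_(m, n)) (B : 'M[R[i]]_(n, p)) :
  mxIm (A *m B) = mxRe A *m mxIm B + mxIm A *m mxRe B.
Proof.
apply/matrixP => i j; rewrite !mxE -big_split/=.
rewrite (big_morph _ complexImD (erefl : complex.Im (0 : R[i]) = 0)).
by apply: eq_bigr => k _; rewrite !mxE complexImM.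
Qed.

Lemma mxRe_complexify m n (A : 'M[R]_(m, n)) : mxRe (map_mx (real_complex R) A) = A.
Proof. by apply/matrixP => i j; rewrite !mxE. Qed.

Lemma mxIm_complexify m n (A : 'M[R]_(m, n)) : mxIm (map_mx (real_complex R) A) = 0.
Proof. by apply/matrixP => i j; rewrite !mxE. Qed.

Lemma mxReZ m n z (X : 'M[R[i]]_(m, n)) :
  mxRe (z *: X) = complex.Re z *: mxRe X - complex.Im z *: mxIm X.
Proof. by apply/matrixP => i j; rewrite !mxE complexReM. Qed.

Lemma mxImZ m n z (X : 'M[R[i]]_(m, n)) :
  mxIm (z *: X) = complex.Re z *: mxIm X + complex.Im z *: mxRe X.
Proof. by apply/matrixP => i j; rewrite !mxE complexImM. Qed.

Lemma mxRe_mulmxl m n p (A : 'M[R]_(m, n)) (X : 'M[R[i]]_(n, p)) :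
  mxRe (map_mx (real_complex R) A *m X) = A *m mxRe X.
Proof. by rewrite mxReM mxRe_complexify mxIm_complexify mul0mx subr0. Qed.

Lemma mxIm_mulmxl m n p (A : 'M[R]_(m, n)) (X : 'M[R[i]]_(n, p)) :
  mxIm (map_mx (real_complex R) A *m X) = A *m mxIm X.
Proof. by rewrite mxImM mxRe_complexify mxIm_complexify mul0mx addr0. Qed.

Lemma mx_complex_eqP m n (A B : 'M[R[i]]_(m, n)) :
  mxRe A = mxRe B -> mxIm A = mxIm B -> A = B.
Proof.
move=> /matrixP AB1 /matrixP AB2; apply/matrixP => i j.
by apply: complex_eqP; [have := AB1 i j|have := AB2 i j]; rewrite !mxE.
Qed.

Definition is_cmx_derive m n (X : R -> 'M[R[i]]_(m, n)) (t : R) (D : 'M[R[i]]_(m, n)) :=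
  is_mx_derive (fun s => mxRe (X s)) t (mxRe D) /\
  is_mx_derive (fun s => mxIm (X s)) t (mxIm D).

Definition cmx_cvg0 m n (X : R -> 'M[R[i]]_(m, n)) :=
  mxRe (X t) @[t --> +oo] --> (0 : 'M[R]_(m, n)) /\
  mxIm (X t) @[t --> +oo] --> (0 : 'M[R]_(m, n)).

Lemma is_cmx_derive_mulmxl m n p (A : 'M[R[i]]_(p, m)) (X : R -> 'M[R[i]]_(m, n)) t D :
  is_cmx_derive X t D -> is_cmx_derive (fun s => A *m X s) t (A *m D).
Proof.
move=> [d1 d2]; split.
- under [X in is_mx_derive X]eq_fun do rewrite mxReM.
  rewrite mxReM; apply: is_mx_deriveD; first exact: is_mx_derive_mulmxl.
  by apply: is_mx_deriveN; exact: is_mx_derive_mulmxl.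
- under [X in is_mx_derive X]eq_fun do rewrite mxImM.
  by rewrite mxImM; apply: is_mx_deriveD; exact: is_mx_derive_mulmxl.
Qed.

Lemma is_cmx_derive_mulmxr m n p (A : 'M[R[i]]_(n, p)) (X : R -> 'M[R[i]]_(m, n)) t D :
  is_cmx_derive X t D -> is_cmx_derive (fun s => X s *m A) t (D *m A).
Proof.
move=> [d1 d2]; split.
- under [X in is_mx_derive X]eq_fun do rewrite mxReM.
  rewrite mxReM; apply: is_mx_deriveD; first exact: is_mx_derive_mulmxr.
  by apply: is_mx_deriveN; exact: is_mx_derive_mulmxr.
- under [X in is_mx_derive X]eq_fun do rewrite mxImM.
  by rewrite mxImM; apply: is_mx_deriveD; exact: is_mx_derive_mulmxr.
Qed.

Lemma cmx_cvg0_0 m n : cmx_cvg0 (fun=> 0 : 'M[R[i]]_(m, n)).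
Proof.
have mxRe0 : mxRe (0 : 'M[R[i]]_(m, n)) = 0 by apply/matrixP => i j; rewrite !mxE.
have mxIm0 : mxIm (0 : 'M[R[i]]_(m, n)) = 0 by apply/matrixP => i j; rewrite !mxE.
by split; rewrite ?mxRe0 ?mxIm0; exact: cvg_cst.
Qed.

Lemma cmx_cvg0D m n (X Y : R -> 'M[R[i]]_(m, n)) :
  cmx_cvg0 X -> cmx_cvg0 Y -> cmx_cvg0 (fun t => X t + Y t).
Proof.
move=> [x1 x2] [y1 y2]; split; rewrite -[0]addr0.
- by under eq_fun do rewrite mxReD; exact: cvgD.
- by under eq_fun do rewrite mxImD; exact: cvgD.
Qed.

Lemma cmx_cvg0_mulmxl m n p (A : 'M[R[i]]_(p, m)) (X : R -> 'M[R[i]]_(m, n)) :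
  cmx_cvg0 X -> cmx_cvg0 (fun t => A *m X t).
Proof.
move=> [x1 x2]; split.
- have -> : 0 = mxRe A *m 0 - mxIm A *m 0 :> 'M[R]_(p, n) by rewrite !mulmx0 subrr.
  by under eq_fun do rewrite mxReM; apply: cvgB; exact: cvg_mulmxl.
- have -> : 0 = mxRe A *m 0 + mxIm A *m 0 :> 'M[R]_(p, n) by rewrite !mulmx0 addr0.
  by under eq_fun do rewrite mxImM; apply: cvgD; exact: cvg_mulmxl.
Qed.

Lemma scalar_decay m n (r : R[i]) (X Y : R -> 'M[R[i]]_(m, n)) :
  complex.Re r < 0 ->
  (forall t, 0 < t -> is_cmx_derive X t (r *: X t + Y t)) ->
  cmx_cvg0 Y -> cmx_cvg0 X.
Proof.
move=> r0 d [/cvg_mxP y1 /cvg_mxP y2].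
suff H i j : complex.Re (X t i j) @[t --> +oo] --> (0 : R) /\
             complex.Im (X t i j) @[t --> +oo] --> (0 : R).
  by split; apply/cvg_mxP => i j; rewrite mxE; under eq_fun do rewrite mxE;
     have [] := H i j.
apply: (@cvg0_of_complex_decay _ r (fun t => complex.Re (X t i j))
  (fun t => complex.Im (X t i j)) (fun t => complex.Re (Y t i j))
  (fun t => complex.Im (Y t i j))) => //.
- move=> t t0; have [/(_ i j) D _] := d t t0.
  apply: is_derive_congr D _ _ => [s|]; first by rewrite mxE.
  by rewrite !mxE complexReD complexReM.
- move=> t t0; have [_ /(_ i j) D] := d t t0.
  apply: is_derive_congr D _ _ => [s|]; first by rewrite mxE.
  by rewrite !mxE complexImD complexImM.
- by have := y1 i j; rewrite mxE; under eq_fun do rewrite mxE.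
- by have := y2 i j; rewrite mxE; under eq_fun do rewrite mxE.
Qed.

End ComplexParts.

(** * Decay of linear systems by peeling off characteristic factors *)

Lemma eigenvalue_trmx (F : fieldType) n (M : 'M[F]_n) (z : F) :
  eigenvalue M^T z = eigenvalue M z.
Proof.
rewrite !eigenvalue_root_char.
by rewrite /char_poly -det_tr /char_poly_mx linearB/= tr_scalar_mx map_trmx trmxK.
Qed.

(** The head of the list is the rightmost factor, the one next to the vector acted upon, so an
    induction on the list can absorb it into that vector. *)
Definition linear_factors (C : comNzRingType) n (M : 'M[C]_n) (rs : seq C) : 'M[C]_n :=
  foldr (fun r N => N *m (M - r%:M)) 1%:M rs.

(** Listing the roots of the characteristic polynomial with multiplicity gives an annihilating
    product without diagonalising [M]. *)
Lemma Cayley_Hamilton_split (C : closedFieldType) n (M : 'M[C]_n) :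
  exists2 rs : seq C, {in rs, forall r, eigenvalue M r} & linear_factors M rs = 0.
Proof.
have [rs rsE] := closed_field_poly_normal (char_poly M).
rewrite (monicP (char_poly_monic M)) scale1r in rsE.
exists rs => [r|].
  by rewrite eigenvalue_root_char rsE root_prod_XsubC.
case: n M rsE => [|n] M rsE; first by apply/matrixP => -[].
rewrite -(Cayley_Hamilton M) rsE; elim: rs {rsE} => [|r rs IH].
  by rewrite big_nil rmorph1.
by rewrite big_cons mulrC rmorphM rmorphB /= horner_mx_X horner_mx_C -IH.
Qed.

Definition hurwitz (R : realType) n (M : 'M[R[i]]_n) : Prop :=
  forall z, eigenvalue M z -> complex.Re z < 0.

(** [Y = (M - r) X] obeys the same equation with forcing [(M - r) f], since [M - r] commutes with
    [M], and it decays by induction on the factors. Then [X' = r X + (Y + f)] is a scalar equation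
    with decaying forcing. *)
Lemma hurwitz_decay (R : realType) n p (M : 'M[R[i]]_n) (X f : R -> 'M[R[i]]_(n, p)) :
  hurwitz M -> (forall t, 0 < t -> is_cmx_derive X t (M *m X t + f t)) ->
  cmx_cvg0 f -> cmx_cvg0 X.
Proof.
move=> hM; have [rs rsM rs0] := Cayley_Hamilton_split M.
have {rs0} : cmx_cvg0 (fun t => linear_factors M rs *m X t).
  rewrite rs0; under eq_fun do rewrite mul0mx.
  exact: cmx_cvg0_0.
elim: rs rsM X f => [|r rs IH] rsM X f X0 dX f0.
  by move: X0; rewrite /=; under eq_fun do rewrite mul1mx.
pose Y t := (M - r%:M) *m X t.
have Y0 : cmx_cvg0 Y.
  apply: (IH _ Y (fun t => (M - r%:M) *m f t)).
  - by move=> z zrs; apply: rsM; rewrite inE zrs orbT.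
  - by move: X0 => /=; under eq_fun do rewrite -mulmxA.
  - move=> t t0; have := is_cmx_derive_mulmxl (M - r%:M) (dX t t0).
    by rewrite mulmxDr !mulmxA mulmxBl mulmxBr scalar_mxC.
  - exact: cmx_cvg0_mulmxl.
apply: (@scalar_decay _ _ _ r X (fun t => Y t + f t)).
- by apply/hM/rsM; rewrite inE eqxx.
- move=> t t0; have := dX t t0.
  rewrite /Y mulmxBl mul_scalar_mx.
  by rewrite [in X in _ -> X]addrA [r *: _ + _]addrC subrK.
- exact: cmx_cvg0D.
Qed.

(** The same peeling on the right: [Y = E (G - r)] obeys the same equation and decays by induction,
    after which [E' = (A + r N) E + N Y] falls under [hurwitz_decay]. *)
Lemma coupled_decay (R : realType) n p (A N : 'M[R[i]]_n) (G : 'M[R[i]]_p)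
    (E : R -> 'M[R[i]]_(n, p)) :
  (forall z, eigenvalue G z -> hurwitz (A + z *: N)) ->
  (forall t, 0 < t -> is_cmx_derive E t (A *m E t + N *m E t *m G)) ->
  cmx_cvg0 E.
Proof.
(* Transposing twice reverses the product, so that the head factor [G - r] stands right after
   [E]. *)
move=> hAN; have [rs rsG rs0] := Cayley_Hamilton_split G^T.
have {rs0} : cmx_cvg0 (fun t => E t *m (linear_factors G^T rs)^T).
  rewrite rs0 trmx0; under eq_fun do rewrite mulmx0.
  exact: cmx_cvg0_0.
have {rsG} : {in rs, forall r, eigenvalue G r}.
  by move=> r /rsG; rewrite eigenvalue_trmx.
elim: rs E => [|r rs IH] E rsG E0 dE.
  by move: E0; rewrite /= trmx1; under eq_fun do rewrite mulmx1.
pose Y t := E t *m (G - r%:M).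
have Y0 : cmx_cvg0 Y.
  apply: (IH Y).
  - by move=> z zrs; apply: rsG; rewrite inE zrs orbT.
  - move: E0 => /=; rewrite trmx_mul linearB/= trmxK tr_scalar_mx.
    by under eq_fun do rewrite mulmxA.
  - move=> t t0; have := is_cmx_derive_mulmxr (G - r%:M) (dE t t0).
    rewrite /Y mulmxDl -!mulmxA; congr (is_cmx_derive _ _ (_ + _ *m (_ *m _))).
    by rewrite mulmxBl mulmxBr scalar_mxC.
apply: (@hurwitz_decay _ _ _ (A + r *: N) E (fun t => N *m Y t)).
- by apply/hAN/rsG; rewrite inE eqxx.
- move=> t t0; have := dE t t0; congr is_cmx_derive.
  rewrite /Y mulmxBr mulmxBr mulmxDl -!addrA; congr (_ + _).
  by rewrite mulmxA mul_mx_scalar -scalemxAr -scalemxAl addrC subrK.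
- exact: cmx_cvg0_mulmxl.
Qed.

(** * The deflated Laplacian *)

(* Maximum principle: along an arc leaving a node where |w| is maximal, w is constant. *)
Lemma laplacian_max_principle (R : realType) p (Gamma : 'M[R]_p) (v : 'I_p)
    (a b : 'I_p -> R) (zr zi : R) :
  (forall i j, i != j -> 0 <= Gamma i j) ->
  (forall i, \sum_(j < p) Gamma i j = 0) ->
  (forall w, w != v -> connect (Defs.arc Gamma) w v) -> 0 <= zr ->
  (forall i, \sum_j Gamma i j * a j = zr * a i - zi * b i) ->
  (forall i, \sum_j Gamma i j * b j = zr * b i + zi * a i) ->
  [/\ forall j, a j ^+ 2 + b j ^+ 2 <= a v ^+ 2 + b v ^+ 2,
      zr * a v - zi * b v = 0 & zr * b v + zi * a v = 0].
Proof.
move=> G0 G1 Gv zr0 ea eb.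
pose N i := a i ^+ 2 + b i ^+ 2.
have [m _ mmax] := @arg_maxP _ _ 'I_p v xpredT N isT.
(* At a maximiser [k] every term of [S0] is nonnegative, while the sum is [- zr * N k <= 0]. All
   terms vanish, and across an arc the equality case, together with [N j <= N k], makes [a + i b]
   agree at [j] and [k]. *)
have step k : N k = N m -> forall j, Gamma k j = 0 \/ (a j = a k /\ b j = b k) \/ j = k.
  move=> Nk j; have [->|jk] := eqVneq j k; first by right; right.
  have S0 : \sum_(l | l != k) Gamma k l * (N k - (a k * a l + b k * b l)) = - zr * N k.
    have -> : - zr * N k = - (a k * (zr * a k - zi * b k) + b k * (zr * b k + zi * a k)).
      by rewrite /N; ring.
    rewrite -ea -eb !mulr_sumr -big_split -sumrN/= [RHS](bigD1 k)//=.
    have -> : - (a k * (Gamma k k * a k) + b k * (Gamma k k * b k)) =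
              \sum_(l | l != k) Gamma k l * N k.
      rewrite -mulr_suml; have := G1 k; rewrite (bigD1 k)//= => /eqP.
      by rewrite addrC addr_eq0 => /eqP ->; rewrite /N; ring.
    by rewrite -big_split/=; apply: eq_bigr => l _; ring.
  have term l : a k * a l + b k * b l <= N k.
    have /= : N l <= N k by rewrite Nk; exact: mmax.
    rewrite /N; have := sqr_ge0 (a k - a l); have := sqr_ge0 (b k - b l).
    by rewrite !sqrrB; lra.
  have T0 l : l != k -> 0 <= Gamma k l * (N k - (a k * a l + b k * b l)).
    by move=> lk; rewrite mulr_ge0 ?subr_ge0// G0// eq_sym.
  have N0 : 0 <= N k by rewrite addr_ge0 ?sqr_ge0.
  have /psumr_eq0P : \sum_(l | l != k) Gamma k l * (N k - (a k * a l + b k * b l)) = 0.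
    by apply/eqP; rewrite eq_le sumr_ge0// S0 andbT mulNr oppr_le0 mulr_ge0.
  move=> /(_ T0 j jk)/eqP; rewrite mulf_eq0 => /orP[/eqP|]; first by left.
  rewrite subr_eq0 => /eqP Nkj; right; left.
  have /= Nj : N j <= N k by rewrite Nk; exact: mmax.
  have : (a j - a k) ^+ 2 + (b j - b k) ^+ 2 <= 0.
    by move: Nj Nkj; rewrite /N; lra.
  have := sqr_ge0 (a j - a k); have := sqr_ge0 (b j - b k) => b2 a2 ab.
  have /eqP : (a j - a k) ^+ 2 = 0 by lra.
  have /eqP : (b j - b k) ^+ 2 = 0 by lra.
  by rewrite !sqrf_eq0 !subr_eq0 => /eqP -> /eqP ->.
(* Maximality travels along the path to [v]: the induction varies the start of the path and keeps
   the maximum [N m] fixed. *)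
have Nv : N v = N m.
  have [->//|mv] := eqVneq m v.
  have /connectP[q] := Gv m mv.
  have : N m = N m by [].
  elim: q {1 3 4}m => [|k q IH] l Nl /=; first by move=> _ ->.
  move=> /andP[lk kq]; apply: IH => //.
  move: lk; rewrite /Defs.arc; case: (step l Nl k) => [->|[[ak bk]|->//]].
    by rewrite ltxx.
  by rewrite /N ak bk.
(* As [v] is a maximiser, [a + i b] takes its value at [v] on all out-neighbours, and row [v] of
   [Gamma] yields that value times a zero row sum. *)
split; first by move=> j; rewrite -!/(N _) Nv; exact: mmax.
- rewrite -ea; transitivity (\sum_j Gamma v j * a v).
    apply: eq_bigr => j _.
    by case: (step v Nv j) => [->|[[-> _]|->//]]; rewrite ?mul0r.
  by rewrite -mulr_suml G1 mul0r.
- rewrite -eb; transitivity (\sum_j Gamma v j * b v).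
    apply: eq_bigr => j _.
    by case: (step v Nv j) => [->|[[_ ->]|->//]]; rewrite ?mul0r.
  by rewrite -mulr_suml G1 mul0r.
Qed.

(* Subtracting 1 r^T moves the simple eigenvalue 0 of Gamma to -1. *)
Lemma hurwitz_deflated_laplacian (R : realType) p (Gamma : 'M[R]_p) (r : 'cV[R]_p) :
  connected_mx Gamma -> r^T *m Gamma = 0 -> r^T *m (const_mx 1 : 'cV[R]_p) = 1%:M ->
  hurwitz (complexify (Gamma - const_mx 1 *m r^T)^T).
Proof.
move=> [G0 G1 [v Gv]] rG r1 z /eigenvalueP[w wE w0]; rewrite ltNge; apply/negP => z0.
pose a i := complex.Re (w 0 i); pose b i := complex.Im (w 0 i).
have re : mxRe w *m (Gamma - const_mx 1 *m r^T)^T =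
    complex.Re z *: mxRe w - complex.Im z *: mxIm w.
  have := congr1 (@mxRe R 1 p) wE.
  rewrite mxReM mxRe_complexify mxIm_complexify mulmx0 subr0 => ->.
  exact: mxReZ.
have im : mxIm w *m (Gamma - const_mx 1 *m r^T)^T =
    complex.Re z *: mxIm w + complex.Im z *: mxRe w.
  have := congr1 (@mxIm R 1 p) wE.
  rewrite mxImM mxRe_complexify mxIm_complexify mulmx0 add0r => ->.
  exact: mxImZ.
(* [r] is a right eigenvector for -1, so multiplying the equation of [w] by [r] gives
   [(z + 1) (w r) = 0]; as [0 <= Re z], [w r = 0]. *)
have Gr : (Gamma - const_mx 1 *m r^T)^T *m r = - r.
  rewrite -[r in _ *m r]trmxK -trmx_mul mulmxBr rG mulmxA r1 mul1mx sub0r.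
  by rewrite linearN/= trmxK.
have sr : mxRe w *m r = 0 /\ mxIm w *m r = 0.
  have := congr1 (fun X => X *m r) re; have := congr1 (fun X => X *m r) im.
  rewrite -!mulmxA Gr !mulmxN mulmxDl mulmxBl -!scalemxAl.
  move: (mxRe w *m r) (mxIm w *m r) => x y /matrixP/(_ 0 0) e1 /matrixP/(_ 0 0) e2.
  rewrite !mxE in e1 e2.
  have c1 : (complex.Re z + 1) * x 0 0 = complex.Im z * y 0 0 by lra.
  have c2 : (complex.Re z + 1) * y 0 0 = - complex.Im z * x 0 0 by lra.
  have c3 : ((complex.Re z + 1) ^+ 2) * (x 0 0 ^+ 2 + y 0 0 ^+ 2) = 0.
    have -> : (complex.Re z + 1) ^+ 2 * (x 0 0 ^+ 2 + y 0 0 ^+ 2) =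
      ((complex.Re z + 1) * x 0 0) * ((complex.Re z + 1) * x 0 0) +
      ((complex.Re z + 1) * y 0 0) * ((complex.Re z + 1) * y 0 0) by ring.
    rewrite {1}c1 {1}c2.
    have -> : complex.Im z * y 0 0 * ((complex.Re z + 1) * x 0 0) +
      - complex.Im z * x 0 0 * ((complex.Re z + 1) * y 0 0) = 0 by ring.
    by [].
  have z1 : (complex.Re z + 1) ^+ 2 != 0 by rewrite sqrf_eq0; apply: lt0r_neq0; lra.
  move/eqP: c3; rewrite mulf_eq0 (negPf z1)/= paddr_eq0 ?sqr_ge0// !sqrf_eq0.
  by move=> /andP[/eqP x0 /eqP y0]; split; apply/matrixP => i j; rewrite !ord1 mxE.
case: sr => [sx sy].
(* The deflation vanishes on rows annihilated by [r], so [w] satisfies the eigenvalue equation of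
   [Gamma] itself. *)
have dG (x : 'rV[R]_p) : x *m r = 0 ->
    x *m (Gamma - const_mx 1 *m r^T)^T = x *m Gamma^T.
  by move=> xr; rewrite linearB/= trmx_mul trmxK mulmxBr mulmxA xr mul0mx subr0.
have sumE (x : 'rV[R]_p) i : \sum_j Gamma i j * x 0 j = (x *m Gamma^T) 0 i.
  by rewrite mxE; apply: eq_bigr => j _; rewrite mxE mulrC.
have ea i : \sum_j Gamma i j * a j = complex.Re z * a i - complex.Im z * b i.
  transitivity ((mxRe w *m Gamma^T) 0 i).
    by rewrite -sumE; apply: eq_bigr => j _; rewrite mxE.
  by rewrite -dG// re !mxE.
have eb i : \sum_j Gamma i j * b j = complex.Re z * b i + complex.Im z * a i.
  transitivity ((mxIm w *m Gamma^T) 0 i).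
    by rewrite -sumE; apply: eq_bigr => j _; rewrite mxE.
  by rewrite -dG// im !mxE.
have [vmax zv1 zv2] := laplacian_max_principle G0 G1 Gv z0 ea eb.
(* This is [|z w_v|^2 = 0]: either [z = 0], or [w] vanishes at the node where its modulus is
   largest. *)
have zab : (complex.Re z ^+ 2 + complex.Im z ^+ 2) * (a v ^+ 2 + b v ^+ 2) = 0.
  have -> : (complex.Re z ^+ 2 + complex.Im z ^+ 2) * (a v ^+ 2 + b v ^+ 2) =
    (complex.Re z * a v - complex.Im z * b v) ^+ 2 +
    (complex.Re z * b v + complex.Im z * a v) ^+ 2 by ring.
  by rewrite zv1 zv2 expr0n addr0.
suff [a0 b0] : (forall i, a i = 0) /\ (forall i, b i = 0).
  case/negP: w0; apply/eqP/matrixP => i j; rewrite ord1 mxE.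
  by apply: complex_eqP; [exact: a0|exact: b0].
move/eqP: zab; rewrite mulf_eq0 => /orP[|].
  rewrite paddr_eq0 ?sqr_ge0// !sqrf_eq0 => /andP[/eqP zr0 /eqP zi0].
  (* Subtracting [x v] stays in the kernel, row sums being 0, and brings the maximum, attained at
     [v], down to 0; [x] is thus constant. The products by 0 give the shape of the eigenvalue
     equations for [z = 0] and a real vector. *)
  have sh (x : 'I_p -> R) : (forall i, \sum_j Gamma i j * x j = 0) ->
      forall i, \sum_j Gamma i j * (x j - x v) = 0 * (x i - x v) - 0 * (0 * x i).
    move=> x0 i; under eq_bigr do rewrite mulrBr.
    by rewrite sumrB x0 -mulr_suml G1; ring.
  have cst (x : 'I_p -> R) : (forall i, \sum_j Gamma i j * x j = 0) ->
      \sum_j x j * r j 0 = 0 -> forall i, x i = 0.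
    move=> x0 xr.
    have [|m _ _] := @laplacian_max_principle _ _ Gamma v (fun i => x i - x v)
      (fun i => 0 * x i) 0 0 G0 G1 Gv (lexx _) (sh x x0).
      by move=> i; rewrite big1 => [|j _]; ring.
    have xv i : x i = x v.
      have := m i; have := sqr_ge0 (x i - x v) => q0 q1.
      have : (x i - x v) ^+ 2 = 0 by move: q1; rewrite subrr !mul0r expr0n/=; lra.
      by move/eqP; rewrite sqrf_eq0 subr_eq0 => /eqP.
    have : x v = 0; last by move=> xv0 i; rewrite xv.
    rewrite -xr; under eq_bigr do rewrite xv.
    rewrite -mulr_sumr; move/matrixP: r1 => /(_ 0 0); rewrite !mxE => r1.
    rewrite -[LHS]mulr1; congr (_ * _); rewrite -[LHS]r1.
    by apply: eq_bigr => j _; rewrite !mxE mulr1.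
  split; apply: cst.
  - by move=> i; rewrite ea zr0 zi0; ring.
  - move/matrixP: sx => /(_ 0 0); rewrite !mxE => sx; rewrite -[RHS]sx.
    by apply: eq_bigr => j _; rewrite mxE.
  - by move=> i; rewrite eb zr0 zi0; ring.
  - move/matrixP: sy => /(_ 0 0); rewrite !mxE => sy; rewrite -[RHS]sy.
    by apply: eq_bigr => j _; rewrite mxE.
move=> /eqP ab0.
have ab i : a i = 0 /\ b i = 0.
  have : a i ^+ 2 + b i ^+ 2 == 0.
    by rewrite eq_le addr_ge0 ?sqr_ge0// andbT -ab0 vmax.
  by rewrite paddr_eq0 ?sqr_ge0// !sqrf_eq0 => /andP[/eqP ? /eqP ?].
by split=> i; have [] := ab i.
Qed.

(** * The averaged Gramian *)

Lemma is_derive_Rintegral (R : realType) (f : R -> R) (t : R) : continuous f -> 0 < t ->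
  is_derive t 1 (fun x => \int[lebesgue_measure]_(s in `[0, x]) f s) (f t).
Proof.
move=> fc t0.
(* The upper end [t + 1] puts [t] in the interior of the interval of integrability. *)
have tt1 : t < t + 1 by rewrite ltrDl.
have fi : lebesgue_measure.-integrable `[0, t + 1] (EFin \o f).
  apply: continuous_compact_integrable; first exact: segment_compact.
  exact: continuous_subspaceT.
have [d <-] := @continuous_FTC1_closed R f 0 t (t + 1) tt1 fi t0 (fc t).
by rewrite derive1E; exact: DeriveDef.
Qed.

(** The mean value theorem on [[T, T + 1]] equates an increment of [h], of size at most [2 e], with
    a value of [dh] within [e] of [q]. With [e = |q| / 4] this gives [|q| <= 3 e], absurd unless
    [q = 0]. *)
Lemma cvg_derive_lim0 (R : realType) (h dh : R -> R) (l q : R) :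
  (forall t : R, 0 < t -> is_derive t 1 h (dh t)) ->
  h t @[t --> +oo] --> l -> dh t @[t --> +oo] --> q -> q = 0.
Proof.
move=> hd /cvgrPdist_le hl /cvgrPdist_le dq; apply/eqP/contraT => q0.
pose e := `|q| / 4.
have e0 : 0 < e by rewrite divr_gt0// normr_gt0.
have [T1 [_ hT]] := hl e e0; have [T2 [_ dT]] := dq e e0.
pose T := Num.max 0 (Num.max T1 T2) + 1.
have [T0 TT1 TT2] : [/\ 0 < T, T1 < T & T2 < T].
  have : Num.max 0 (Num.max T1 T2) < T by rewrite ltrDl.
  by rewrite !gt_max => /and3P[].
have T1T : T <= T + 1 by rewrite lerDl.
have [c /andP[Tc _] /(canRL (subrK _)) hE] := MVT_gt0 T0 T1T hd.
have TT : T1 < T + 1 by lra.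
have cT : T2 < c by lra.
have a1 := hT _ TT1; have a2 := hT _ TT; have a3 := dT _ cT.
move: a1 a2 a3; rewrite /= !ler_norml => /andP[? ?] /andP[? ?] /andP[? ?].
have : `|q| <= 3 * e by rewrite ler_norml; apply/andP; split; lra.
by rewrite /e; move: e0; rewrite /e; lra.
Qed.

Section MeanGram.
Context (R : realType) (n : nat) (F : 'M[R]_n).

Let E (t : R) := expmx (t *: F).

Let dE t : is_mx_derive E t (E t *m F).
Proof. by rewrite /E -expmx_comm; exact: expmx_derive. Qed.

(** [x + i y] is an eigenvector for [i w], so the flow only rotates the pair: the two cross terms in
    the derivative cancel. *)
Lemma expmx_norm_const (w : R) (x y : 'cV[R]_n) (t : R) :
  F *m x = - w *: y -> F *m y = w *: x ->
  (E t *m x)^T *m (E t *m x) + (E t *m y)^T *m (E t *m y) = x^T *m x + y^T *m y.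
Proof.
move=> Fx Fy.
pose phi s := (E s *m x)^T *m (E s *m x) + (E s *m y)^T *m (E s *m y).
have -> : x^T *m x + y^T *m y = phi 0 by rewrite /phi /E expmx0 !mul1mx.
rewrite -/(phi t); apply: is_mx_derive0_cst => s.
have dx : is_mx_derive (fun s => E s *m x) s (- w *: (E s *m y)).
  apply: is_mx_derive_eq; first exact/is_mx_derive_mulmxr/dE.
  by rewrite -mulmxA Fx scalemxAr.
have dy : is_mx_derive (fun s => E s *m y) s (w *: (E s *m x)).
  apply: is_mx_derive_eq; first exact/is_mx_derive_mulmxr/dE.
  by rewrite -mulmxA Fy scalemxAr.
apply: is_mx_derive_eq.
  apply: is_mx_deriveD; apply: is_mx_deriveM.
  - exact/is_mx_derive_tr/dx.
  - exact: dx.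
  - exact/is_mx_derive_tr/dy.
  - exact: dy.
rewrite ![(_ *: _)^T]linearZ/= -!scalemxAl -!scalemxAr !scaleNr.
set a := (E s *m y)^T *m (E s *m x); set b := (E s *m x)^T *m (E s *m y).
by rewrite -opprD [w *: b + _]addrC addNr.
Qed.

Let g (t : R) := (E t)^T *m E t.

Let dg t : is_mx_derive g t (F^T *m g t + g t *m F).
Proof.
apply: is_mx_derive_eq.
  by apply: is_mx_deriveM; [exact/is_mx_derive_tr/dE|exact: dE].
by rewrite trmx_mul /g !mulmxA.
Qed.

Let I (t : R) : 'M[R]_n :=
  \matrix_(i, j) \int[lebesgue_measure]_(tau in `[0, t]) g tau i j.

Let dI t : 0 < t -> is_mx_derive I t (g t).
Proof.
move=> t0 i j.
have gc : continuous (fun s => g s i j).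
  move=> s; apply: differentiable_continuous; apply/derivable1_diffP.
  by have [] := dg s i j.
apply: is_derive_congr (is_derive_Rintegral gc t0) _ _ => // s.
by rewrite mxE.
Qed.

Let mean_gramE t : mean_gram F t = t^-1 *: I t.
Proof.
rewrite /mean_gram; congr (_ *: _); apply/matrixP => i j; rewrite !mxE.
by apply: eq_Rintegral => s _; rewrite expmx_tr.
Qed.

Context (P : 'M[R]_n) (IP : mean_gram F t @[t --> +oo] --> P).

Let IP' : t^-1 *: I t @[t --> +oo] --> P.
Proof. by have := IP; under eq_fun do rewrite mean_gramE. Qed.

Let cvgV : t^-1 @[t --> +oo] --> (0 : R).
Proof. by apply/gtr0_cvgV0; [exact: nbhs_pinfty_gt|exact: cvg_id]. Qed.

Lemma mean_gram_lim_sym : P^T = P.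
Proof.
apply: esym; apply: (cvg_unique (@norm_hausdorff _ _) IP').
rewrite (_ : (fun _ => _) = fun t => (t^-1 *: I t)^T); first exact: cvg_trmx.
apply/funext => t; rewrite linearZ/=; congr (_ *: _).
apply/matrixP => i j; rewrite !mxE; apply: eq_Rintegral => s _.
have gs : (g s)^T = g s by rewrite /g trmx_mul trmxK.
by rewrite -[g s in LHS]gs mxE.
Qed.

Let quad (u v : 'cV[R]_n) t : is_mx_derive I t (g t) ->
  is_derive t 1 (fun s => (u^T *m I s *m v) 0 0) ((u^T *m g t *m v) 0 0).
Proof.
by move=> d; have := is_mx_derive_mulmxr v (is_mx_derive_mulmxl u^T d); apply.
Qed.

Let quad_cvg (u v : 'cV[R]_n) :
  t^-1 * (u^T *m I t *m v) 0 0 @[t --> +oo] --> (u^T *m P *m v) 0 0.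
Proof.
have q : u^T *m (t^-1 *: I t) *m v @[t --> +oo] --> u^T *m P *m v.
  by apply: cvg_mulmxr; exact: cvg_mulmxl.
move/cvg_mxP : q => /(_ 0 0).
by under eq_fun do rewrite -scalemxAr -scalemxAl mxE.
Qed.

(** The form [x^T I(t) x] is nondecreasing, with derivative [|e^{Ft} x|^2]. Its value at 1, divided
    by [t], is a lower bound tending to 0. *)
Lemma mean_gram_lim_ge0 (x : 'cV[R]_n) : 0 <= (x^T *m P *m x) 0 0.
Proof.
have c : t^-1 * (x^T *m I 1 *m x) 0 0 @[t --> +oo] --> (0 : R).
  by rewrite -[X in _ --> X](mul0r ((x^T *m I 1 *m x) 0 0)); apply: cvgM cvgV (cvg_cst _).
have q := @quad_cvg x x.
apply: (ler_cvg_to c q); near=> t.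
have t1 : 1 <= t by near: t; apply: nbhs_pinfty_ge; exact: num_real.
rewrite ler_wpM2l ?invr_ge0 ?(le_trans _ t1)// -lerN2.
apply: (@ler0_is_derive_nincr R (fun t => - (x^T *m I t *m x) 0 0)
  (fun t => - (x^T *m g t *m x) 0 0)) => // [s s0|s _ _].
  by apply: is_deriveN; apply: quad; exact: dI.
rewrite oppr_le0 /g mulmxA -mulmxA -trmx_mul mxE sumr_ge0// => k _.
by rewrite mxE -expr2 sqr_ge0.
Unshelve. all: by end_near. Qed.

(** By [expmx_norm_const] the sum of the two integrated forms has constant derivative [c]; it is
    affine for [1 <= t], and its mean tends to the slope. *)
Lemma mean_gram_lim_eigen (w : R) (x y : 'cV[R]_n) :
  F *m x = - w *: y -> F *m y = w *: x ->
  (x^T *m P *m x) 0 0 + (y^T *m P *m y) 0 0 = (x^T *m x) 0 0 + (y^T *m y) 0 0.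
Proof.
move=> Fx Fy.
pose phi t := (x^T *m I t *m x) 0 0 + (y^T *m I t *m y) 0 0.
pose c := (x^T *m x) 0 0 + (y^T *m y) 0 0.
have dphi (t : R) : 0 < t -> is_derive t 1 phi c.
  move=> t0; have d := dI t0.
  apply: is_derive_congr (is_deriveD (@quad x x t d) (@quad y y t d)) _ _ => //.
  have add00 (a b : 'M[R]_1) : a 0 0 + b 0 0 = (a + b) 0 0 by rewrite mxE.
  by rewrite /c !add00 -(expmx_norm_const t Fx Fy) /g !trmx_mul !mulmxA.
have phiE t : 1 <= t -> phi t = phi 1 + c * (t - 1).
  move=> t1; have [s _ /(canRL (subrK _)) ->] := MVT_gt0 ltr01 t1 dphi.
  by rewrite addrC.
have l1 : t^-1 * phi t @[t --> +oo] --> (x^T *m P *m x) 0 0 + (y^T *m P *m y) 0 0.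
  under eq_fun do rewrite mulrDr.
  by apply: cvgD; exact: quad_cvg.
apply: (cvg_unique (@Rhausdorff R) l1).
have : t^-1 * (phi 1 - c) + c @[t --> +oo] --> 0 * (phi 1 - c) + c.
  by apply: cvgD (cvg_cst _); apply: cvgM cvgV (cvg_cst _).
rewrite mul0r add0r; apply: cvg_trans; apply: near_eq_cvg; near=> t.
have t1 : 1 <= t by near: t; apply: nbhs_pinfty_ge; exact: num_real.
rewrite (phiE t t1).
have tn : t != 0 by apply: lt0r_neq0; lra.
have aux (u k : R) : t^-1 * (u - k) + k = t^-1 * (u + k * (t - 1)) by field.
by rewrite aux.
Unshelve. all: by end_near. Qed.

(* F^T I + I F - g is constant, so g(t)/t converges to Q := F^T P + P F; as the
   mean M = I/t has derivative (g - M)/t and converges, Q = 0.  No bound on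
   e^{Ft} is needed. *)
Lemma mean_gram_lim_skew : F^T *m P + P *m F = 0.
Proof.
pose J t := F^T *m I t + I t *m F - g t.
have JE t : 1 <= t -> J t = J 1.
  move=> t1; apply/matrixP => i j.
  have dJ (s : R) : 0 < s -> is_derive s 1 (fun u => J u i j) 0.
    move=> s0; have d := dI s0.
    have := is_mx_deriveD (is_mx_deriveD (is_mx_derive_mulmxl F^T d)
      (is_mx_derive_mulmxr F d)) (is_mx_deriveN (dg s)).
    by rewrite subrr => /(_ i j); rewrite mxE.
  have [s _] := MVT_gt0 ltr01 t1 dJ.
  by rewrite mul0r => /eqP; rewrite subr_eq0 => /eqP.
have gQ : t^-1 *: g t @[t --> +oo] --> F^T *m P + P *m F.
  have : F^T *m (t^-1 *: I t) + (t^-1 *: I t) *m F - t^-1 *: J 1 @[t --> +oo] -->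
      F^T *m P + P *m F - 0 *: J 1.
    apply: cvgB; last exact: cvgZ cvgV (cvg_cst _).
    by apply: cvgD; [exact: cvg_mulmxl|exact: cvg_mulmxr].
  rewrite scale0r subr0; apply: cvg_trans; apply: near_eq_cvg; near=> t.
  have t1 : 1 <= t by near: t; apply: nbhs_pinfty_ge; exact: num_real.
  by rewrite -(JE t t1) -scalemxAr -scalemxAl -scalerDr -scalerBr /J opprB addrC subrK.
apply/matrixP => i j; rewrite [RHS]mxE.
move/cvg_mxP : gQ => /(_ i j) gQ; move/cvg_mxP : IP' => /(_ i j) IPij.
apply: (@cvg_derive_lim0 R (fun t => t^-1 * I t i j)
  (fun t => t^-1 * g t i j - t^-1 * (t^-1 * I t i j)) (P i j)).
- move=> t t0; have tn : t != 0 by apply: lt0r_neq0; lra.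
  have dV := is_deriveV tn (is_derive_id t (1 : R)).
  apply: is_derive_congr (is_deriveM dV (dI t0 i j)) _ _ => //.
  by rewrite /GRing.scale/= !mulr1; field.
- by move: IPij; under eq_fun do rewrite mxE.
- rewrite -[X in _ --> X]subr0 -[X in _ - X](mul0r (P i j)); apply: cvgB.
    by move: gQ; under eq_fun do rewrite mxE.
  apply: cvgM cvgV _.
  by move: IPij; under eq_fun do rewrite mxE.
Unshelve. all: by end_near. Qed.

End MeanGram.

(** * Spectrum and visible modes *)

Lemma char_poly_similar (C : comNzRingType) n q (V : 'M[C]_(n, q)) (V' : 'M[C]_(q, n))
    (A : 'M[C]_n) :
  n = q -> V *m V' = 1%:M -> V' *m V = 1%:M -> char_poly (V' *m A *m V) = char_poly A.
Proof.
move=> nq; case: _ / nq V V' => V V' VV' V'V.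
rewrite /char_poly; have -> : char_poly_mx (V' *m A *m V) =
    map_mx polyC V' *m char_poly_mx A *m map_mx polyC V :> 'M[{poly C}]_n.
  rewrite /char_poly_mx mulmxBr mulmxBl !map_mxM; congr (_ - _).
  by rewrite mul_mx_scalar -scalemxAl -map_mxM V'V map_mx1 scalemx1.
rewrite !det_mulmx mulrAC -det_mulmx -map_mxM V'V.
by rewrite map_mx1 det1 mul1r.
Qed.

Lemma char_poly_block_diag (C : comNzRingType) p q (F : 'M[C]_p) (G : 'M[C]_q) :
  char_poly (block_mx F 0 0 G) = char_poly F * char_poly G.
Proof. by rewrite /char_poly char_block_diag_mx det_ublock. Qed.

Lemma eigenvalue_colP (C : fieldType) n (M : 'M[C]_n) (z : C) :
  eigenvalue M z <-> exists2 v : 'cV[C]_n, M *m v = z *: v & v != 0.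
Proof.
rewrite -eigenvalue_trmx; split=> [/eigenvalueP[v vE v0]|[v vE v0]].
  exists v^T; last by rewrite trmx_eq0.
  by rewrite -[M]trmxK -trmx_mul vE linearZ.
apply/eigenvalueP; exists v^T; last by rewrite trmx_eq0.
by rewrite -trmx_mul vE linearZ.
Qed.

Section Spectrum.
Context (R : realType).

Lemma spectrumE n (A : 'M[R]_n) :
  char_poly (complexify A) = \prod_(z <- spectrum A) ('X - z%:P).
Proof.
rewrite /spectrum; case: closed_field_poly_normal => rs /= {1}->.
by rewrite (monicP (char_poly_monic _)) scale1r.
Qed.

Lemma mem_spectrum n (A : 'M[R]_n) z : (z \in spectrum A) = eigenvalue (complexify A) z.
Proof. by rewrite eigenvalue_root_char spectrumE root_prod_XsubC. Qed.

Lemma size_spectrum n (A : 'M[R]_n) : size (spectrum A) = n.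
Proof.
have := size_char_poly (complexify A).
by rewrite spectrumE size_prod_XsubC => -[].
Qed.

(* The n1 imaginary eigenvalues of A are exhausted by F. *)
Lemma complement_not_imaginary n n2 (A : 'M[R]_n)
    (V : 'M[R]_(n, imag_eig_count A + n2)) (V' : 'M[R]_(imag_eig_count A + n2, n))
    (F : 'M[R]_(imag_eig_count A)) (G : 'M[R]_n2) :
  V *m V' = 1%:M -> V' *m V = 1%:M -> V' *m A *m V = block_mx F 0 0 G ->
  (forall z, eigenvalue (complexify F) z -> complex.Re z = 0) ->
  forall z, eigenvalue (complexify G) z -> complex.Re z != 0.
Proof.
move=> VV' V'V VAV F0 z zG.
have nq : n = (imag_eig_count A + n2)%N.
  by apply/eqP; rewrite eqn_leq (mulmx1_min VV') (mulmx1_min V'V).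
(* Characteristic polynomials multiply over the blocks, and a product of monic linear factors
   determines its roots up to order. *)
have e : perm_eq (spectrum A) (spectrum F ++ spectrum G).
  apply: prod_XsubC_eq; rewrite big_cat/= -!spectrumE -char_poly_block_diag.
  rewrite -(@char_poly_similar _ _ _ (map_mx (real_complex R) V)
              (map_mx (real_complex R) V') _ nq).
  - by rewrite -!map_mxM VAV map_block_mx !map_mx0.
  - by rewrite -map_mxM VV' map_mx1.
  - by rewrite -map_mxM V'V map_mx1.
have cF : count (fun z : R[i] => complex.Re z == 0) (spectrum F) = imag_eig_count A.
  rewrite -[RHS](size_spectrum F); apply/eqP; rewrite -all_count.
  by apply/allP => u; rewrite mem_spectrum => /F0 ->.
have /permP/(_ (fun z : R[i] => complex.Re z == 0)) := e.
rewrite count_cat cF -/(imag_eig_count A) -[LHS]addn0 => /addnI/esym/eqP.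
rewrite -leqn0 leqNgt -has_count => /hasPn; apply.
by rewrite mem_spectrum.
Qed.

End Spectrum.

(** * Undamped modes seen through the input *)

Lemma mulmx_trl_ge0 (R : realDomainType) n (x : 'cV[R]_n) : 0 <= (x^T *m x) 0 0.
Proof. by rewrite mxE sumr_ge0// => k _; rewrite mxE -expr2 sqr_ge0. Qed.

Lemma mulmx_trl_eq0 (R : realDomainType) n (x : 'cV[R]_n) :
  (x^T *m x) 0 0 = 0 -> x = 0.
Proof.
rewrite mxE => /psumr_eq0P H; apply/matrixP => k j; rewrite ord1 mxE.
have := H _ k isT; rewrite mxE -expr2 => /(_ _)/eqP.
rewrite sqrf_eq0 => E; apply/eqP/E => l _.
by rewrite mxE -expr2 sqr_ge0.
Qed.

Section ClosedLoop.
Context (R : realType) (m n : nat).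

(* A pair x + i y spanning an imaginary eigenspace of A^T does not decay, so it
   must be visible through B^T. *)
Lemma stabilizable_imag_eigen (A : 'M[R]_n) (B : 'M[R]_(n, m)) (w : R) (x y : 'cV[R]_n) :
  stabilizable A B -> A^T *m x = - w *: y -> A^T *m y = w *: x ->
  B^T *m x = 0 -> B^T *m y = 0 -> x = 0 /\ y = 0.
Proof.
move=> sAB Ax Ay Bx By.
(* The span of [x] and [y] is invariant under [A^T] and killed by [B^T]. *)
have BA k : B^T *m A^T ^+ k *m x = 0 /\ B^T *m A^T ^+ k *m y = 0.
  elim: k => [|k [IHx IHy]]; first by rewrite expr0 mulmx1.
  rewrite exprSr -[_ * _]/(_ *m _) !mulmxA -!(mulmxA _ A^T) Ax Ay -!scalemxAr.
  by rewrite IHx IHy !scaler0.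
have cx : expmx (t *: A^T) *m x @[t --> +oo] --> (0 : 'cV[R]_n).
  by apply: sAB => t _; apply: expmx_mul0 => k; have [] := BA k.
have cy : expmx (t *: A^T) *m y @[t --> +oo] --> (0 : 'cV[R]_n).
  by apply: sAB => t _; apply: expmx_mul0 => k; have [] := BA k.
(* The flow preserves the sum of squared norms, yet both vectors tend to 0. *)
have c0 : x^T *m x + y^T *m y = 0.
  have c : (expmx (t *: A^T) *m x)^T *m (expmx (t *: A^T) *m x) +
           (expmx (t *: A^T) *m y)^T *m (expmx (t *: A^T) *m y) @[t --> +oo] -->
           ((0 : 'cV[R]_n)^T *m (0 : 'cV[R]_n) + (0 : 'cV[R]_n)^T *m (0 : 'cV[R]_n)).
    by apply: cvgD; apply: cvg_mulmx => //; exact: cvg_trmx.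
  move: c; under eq_fun do rewrite (expmx_norm_const _ Ax Ay).
  rewrite !mulmx0 addr0 => c.
  by apply: (cvg_unique (@norm_hausdorff _ _) _ c); exact: cvg_cst.
move/matrixP/(_ 0 0) : c0; rewrite mxE [RHS]mxE => c0.
have x0 := mulmx_trl_ge0 x; have y0 := mulmx_trl_ge0 y.
by split; apply: mulmx_trl_eq0; lra.
Qed.

(** Since [F^T P = - P F], the vectors [Ud^T P x] and [Ud^T P y] form a mode of [A^T] of frequency
    [- w], invisible through [B^T], hence zero. Left multiplication by [U^T] gives [P x = P y = 0],
    and [mean_gram_lim_eigen] then kills [x] and [y]. *)
Lemma mean_gram_gain_visible n1 (A : 'M[R]_n) (B : 'M[R]_(n, m)) (U : 'M[R]_(n, n1))
    (Ud : 'M[R]_(n1, n)) (F P : 'M[R]_n1) (w : R) (x y : 'cV[R]_n1) :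
  stabilizable A B -> Ud *m U = 1%:M -> Ud *m A = F *m Ud ->
  mean_gram F t @[t --> +oo] --> P ->
  F *m x = - w *: y -> F *m y = w *: x ->
  (Ud *m B)^T *m P *m x = 0 -> (Ud *m B)^T *m P *m y = 0 -> x = 0 /\ y = 0.
Proof.
move=> sAB UdU UdA FP Fx Fy Bx By.
have PF : F^T *m P = - (P *m F).
  by apply/eqP; rewrite -addr_eq0; apply/eqP; exact: mean_gram_lim_skew FP.
have AU : A^T *m Ud^T = Ud^T *m F^T by rewrite -!trmx_mul UdA.
have [] := @stabilizable_imag_eigen A B (- w) (Ud^T *m (P *m x)) (Ud^T *m (P *m y)) sAB.
- rewrite mulmxA AU -mulmxA (mulmxA F^T) PF mulNmx -mulmxA Fx.
  by rewrite -!scalemxAr mulmxN -scalemxAr !scaleNr.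
- rewrite mulmxA AU -mulmxA (mulmxA F^T) PF mulNmx -mulmxA Fy.
  by rewrite -!scalemxAr mulmxN -scalemxAr scaleNr.
- by move: Bx; rewrite trmx_mul -!mulmxA.
- by move: By; rewrite trmx_mul -!mulmxA.
move=> /(congr1 (mulmx U^T)) Px /(congr1 (mulmx U^T)) Py.
rewrite mulmxA -trmx_mul UdU trmx1 mul1mx mulmx0 in Px.
rewrite mulmxA -trmx_mul UdU trmx1 mul1mx mulmx0 in Py.
have := mean_gram_lim_eigen FP Fx Fy.
rewrite -!mulmxA Px Py !mulmx0 [(0 : 'M[R]_1) 0 0]mxE addr0 => c0.
have x0 := mulmx_trl_ge0 x; have y0 := mulmx_trl_ge0 y.
by split; apply: mulmx_trl_eq0; lra.
Qed.

End ClosedLoop.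

(** * The closed loop *)

Lemma trmx00 (R : Type) (M : 'M[R]_1) : M^T 0 0 = M 0 0.
Proof. by rewrite mxE. Qed.

(* Pairing F a + lambda Bu Bu^T P a = mu a with a^* P, the skew part P F drops out
   and Re lambda |Bu^T P a|^2 = Re mu (a^* P a) remains. *)
Lemma gain_energy (R : realType) n m (F P : 'M[R]_n) (B : 'M[R]_(n, m))
    (l1 l2 m1 m2 : R) (x y : 'cV[R]_n) :
  P^T = P -> F^T *m P + P *m F = 0 ->
  0 <= (x^T *m P *m x) 0 0 -> 0 <= (y^T *m P *m y) 0 0 -> l1 < 0 -> 0 <= m1 ->
  F *m x + (l1 *: (B *m (B^T *m P *m x)) - l2 *: (B *m (B^T *m P *m y))) =
    m1 *: x - m2 *: y ->
  F *m y + (l1 *: (B *m (B^T *m P *m y)) + l2 *: (B *m (B^T *m P *m x))) =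
    m1 *: y + m2 *: x ->
  B^T *m P *m x = 0 /\ B^T *m P *m y = 0.
Proof.
move=> PT PF Px Py l10 m10 ex ey.
set c1 := B^T *m P *m x in ex ey *; set c2 := B^T *m P *m y in ex ey *.
have c1T : x^T *m P *m B = c1^T by rewrite /c1 !trmx_mul trmxK PT mulmxA.
have c2T : y^T *m P *m B = c2^T by rewrite /c2 !trmx_mul trmxK PT mulmxA.
(* A scalar equals its transpose, and [PF] makes this transpose its negative. *)
have skew (u : 'cV[R]_n) : (u^T *m P *m (F *m u)) 0 0 = 0.
  have e : (u^T *m P *m (F *m u))^T = - (u^T *m P *m (F *m u)).
    move/eqP: PF; rewrite addr_eq0 => /eqP PF.
    rewrite !trmx_mul trmxK PT -!mulmxA (mulmxA F^T) PF mulNmx mulmxN.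
    by rewrite -!mulmxA.
  by have := trmx00 (u^T *m P *m (F *m u)); rewrite e [LHS]mxE => ?; lra.
have D00 (u v : 'M[R]_1) : (u + v) 0 0 = u 0 0 + v 0 0 by rewrite mxE.
have N00 (u : 'M[R]_1) : (- u) 0 0 = - u 0 0 by rewrite mxE.
have Z00 k (u : 'M[R]_1) : (k *: u) 0 0 = k * u 0 0 by rewrite mxE.
have e1 := congr1 (fun M : 'cV[R]_n => (x^T *m P *m M) 0 0) ex.
have e2 := congr1 (fun M : 'cV[R]_n => (y^T *m P *m M) 0 0) ey.
have sxy : (y^T *m P *m x) 0 0 = (x^T *m P *m y) 0 0.
  by rewrite -trmx00 !trmx_mul trmxK PT mulmxA.
have sc : (c2^T *m c1) 0 0 = (c1^T *m c2) 0 0.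
  by rewrite -trmx00 trmx_mul trmxK.
have {}e1 : l1 * (c1^T *m c1) 0 0 - l2 * (c1^T *m c2) 0 0 =
    m1 * (x^T *m P *m x) 0 0 - m2 * (x^T *m P *m y) 0 0.
  move: e1; rewrite !mulmxDr !mulmxN -!scalemxAr !(mulmxA _ B) c1T.
  by rewrite !(D00, N00, Z00) skew add0r.
have {}e2 : l1 * (c2^T *m c2) 0 0 + l2 * (c2^T *m c1) 0 0 =
    m1 * (y^T *m P *m y) 0 0 + m2 * (y^T *m P *m x) 0 0.
  move: e2; rewrite !mulmxDr -!scalemxAr !(mulmxA _ B) c2T.
  by rewrite !(D00, N00, Z00) skew add0r.
rewrite sc sxy in e2.
have q1 := mulmx_trl_ge0 c1; have q2 := mulmx_trl_ge0 c2.
(* Adding [e1] and [e2] cancels the cross terms and leaves [l1 (|c1|^2 + |c2|^2) = m1 (x^T P x + y^T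
   P y)], where [l1 < 0] and the right side is nonnegative. *)
have q : (c1^T *m c1) 0 0 + (c2^T *m c2) 0 0 <= 0.
  rewrite -(ler_nM2l l10) mulr0 mulrDr.
  have -> : l1 * (c1^T *m c1) 0 0 + l1 * (c2^T *m c2) 0 0 =
    m1 * ((x^T *m P *m x) 0 0 + (y^T *m P *m y) 0 0) by rewrite mulrDr; lra.
  by rewrite mulr_ge0// addr_ge0.
by split; apply: mulmx_trl_eq0; lra.
Qed.

Lemma closed_loop_hurwitz (R : realType) m n (A : 'M[R]_n) (B : 'M[R]_(n, m))
    (K : 'M[R]_(m, n)) (l : R[i]) :
  neutrally_stable A -> stabilizable A B -> is_gain A B K -> complex.Re l < 0 ->
  hurwitz (complexify A + l *: map_mx (real_complex R) (B *m K)).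
Proof.
move=> [hA _] sAB gK l0 mu /eigenvalue_colP[v vE v0]; rewrite ltNge; apply/negP => mu0.
(* If [K v = 0], then [v] is an eigenvector of [A] itself, and neutral stability forces [mu], with
   [0 <= Re mu], onto the imaginary axis. *)
have AK : map_mx (real_complex R) K *m v = 0 ->
    complexify A *m v = mu *: v /\ complex.Re mu = 0.
  move=> Kv; have Av : complexify A *m v = mu *: v.
    by rewrite -vE mulmxDl -scalemxAl map_mxM -mulmxA Kv mulmx0 scaler0 addr0.
  split=> //; apply/eqP; rewrite eq_le mu0 andbT leNgt; apply/negP/hA.
  by apply/eigenvalue_colP; exists v.
move: gK; rewrite /is_gain; case: eqP => [n10 K0|_].
  have [|Av mu0'] := AK; first by rewrite K0 map_mx0 mul0mx.
  have : mu \in spectrum A by rewrite mem_spectrum; apply/eigenvalue_colP; exists v.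
  move=> muA; have : has (fun z : R[i] => complex.Re z == 0) (spectrum A).
    by apply/hasP; exists mu => //; apply/eqP.
  by rewrite has_count -/(imag_eig_count A) n10.
move=> [U [W [Ud [Wd [F [G [P [[VV VV'] VAV F0 FP KE]]]]]]]].
have [UdA WdA] : Ud *m A = F *m Ud /\ Wd *m A = G *m Wd.
  apply: eq_col_mx; rewrite -mul_col_mx.
  transitivity (col_mx Ud Wd *m A *m row_mx U W *m col_mx Ud Wd).
    by rewrite -[RHS]mulmxA VV mulmx1.
  by rewrite VAV mul_block_col !mul0mx addr0 add0r.
have [UdU _ _ _] : [/\ Ud *m U = 1%:M, Ud *m W = 0, Wd *m U = 0 & Wd *m W = 1%:M].
  by apply: eq_block_mx; rewrite -mul_col_row VV' -scalar_mx_block.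
have PT := mean_gram_lim_sym FP.
have PF := mean_gram_lim_skew FP.
have Pge := mean_gram_lim_ge0 FP.
(* If [Ud v = 0], the gain vanishes on [v] and [Wd v] is an eigenvector of [G] for an imaginary
   [mu], which [complement_not_imaginary] excludes. *)
have [a0|a0] := eqVneq (map_mx (real_complex R) Ud *m v) 0.
  have [|Av mu0'] := AK.
    by rewrite KE !map_mxM -!mulmxA a0 !mulmx0.
  have : eigenvalue (complexify G) mu.
    apply/eigenvalue_colP; exists (map_mx (real_complex R) Wd *m v).
      by rewrite mulmxA -map_mxM -WdA map_mxM -mulmxA Av scalemxAr.
    apply: contra v0 => /eqP b0; apply/eqP.
    have : map_mx (real_complex R) (row_mx U W *m col_mx Ud Wd) *m v = v.
      by rewrite VV map_mx1 mul1mx.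
    by rewrite mul_row_col map_mxD !map_mxM mulmxDl -!mulmxA a0 b0 !mulmx0 addr0.
  by move=> /(complement_not_imaginary VV VV' VAV F0)/eqP.
have aE : map_mx (real_complex R) F *m (map_mx (real_complex R) Ud *m v) +
    l *: (map_mx (real_complex R) (Ud *m B) *m (map_mx (real_complex R)
      ((Ud *m B)^T *m P) *m (map_mx (real_complex R) Ud *m v))) =
    mu *: (map_mx (real_complex R) Ud *m v).
  have := congr1 (mulmx (map_mx (real_complex R) Ud)) vE.
  rewrite -scalemxAr => <-.
  rewrite mulmxDl mulmxDr -scalemxAl -scalemxAr KE.
  by rewrite !mulmxA -!map_mxM UdA !mulmxA.
move: (map_mx (real_complex R) Ud *m v) a0 aE => a a0 aE.
have ex := congr1 (@mxRe R _ _) aE; have ey := congr1 (@mxIm R _ _) aE.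
rewrite mxReD !mxReZ !mxRe_mulmxl !mxIm_mulmxl in ex.
rewrite mxImD !mxImZ !mxRe_mulmxl !mxIm_mulmxl in ey.
have [Bx By] := gain_energy PT PF (Pge _) (Pge _) l0 mu0 ex ey.
(* By [Bx] and [By] the feedback drops out, so [mu] is an eigenvalue of [F], hence imaginary. *)
have Fa : complexify F *m a = mu *: a.
  apply: mx_complex_eqP.
  - by rewrite mxRe_mulmxl mxReZ -ex Bx By !mulmx0 !scaler0 subr0 addr0.
  - by rewrite mxIm_mulmxl mxImZ -ey Bx By !mulmx0 !scaler0 !addr0.
have mu0' : complex.Re mu = 0 by apply: F0; apply/eigenvalue_colP; exists a.
rewrite mu0' Bx By !mulmx0 !scaler0 !scale0r subr0 !addr0 add0r -scaleNr in ex.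
rewrite mu0' Bx By !mulmx0 !scaler0 !scale0r !addr0 add0r in ey.
have [x0 y0] := mean_gram_gain_visible sAB UdU UdA FP ex ey Bx By.
case/negP: a0; apply/eqP/mx_complex_eqP.
- by rewrite x0; apply/matrixP => i j; rewrite !mxE.
- by rewrite y0; apply/matrixP => i j; rewrite !mxE.
Qed.

(** * Synchronization *)

(** [e^{-uA} s(u)] has zero derivative for [0 < u]; continuity at 0 lets the mean value theorem
    reach the initial value. *)
Lemma expmx_unique (R : realType) n (A : 'M[R]_n) (s : R -> 'cV[R]_n) :
  {within `[0, +oo[, continuous s} ->
  (forall t, 0 < t -> is_mx_derive s t (A *m s t)) ->
  forall t, 0 <= t -> s t = expmx (t *: A) *m s 0.
Proof.
move=> sc ds t t0.
pose y u := expmx (u *: - A) *m s u.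
have dy u : 0 < u -> is_mx_derive y u 0.
  move=> u0; apply: is_mx_derive_eq.
    by apply: is_mx_deriveM; [exact: expmxN_derive|exact: ds].
  by rewrite mulmxA -mulNmx expmx_comm mulmxN mulNmx addNr.
have yc : {within `[0, +oo[, continuous y}.
  move=> u; apply: cvg_mulmx; last exact: sc.
  have ec : continuous (fun u : R => expmx (u *: - A)).
    move=> v; apply/cvg_mxP => i j; apply: differentiable_continuous.
    by apply/derivable1_diffP; have [] := @expmxN_derive R n A v i j.
  exact: (continuous_subspaceT ec).
suff -> : s 0 = y t by rewrite /y mulmxA expmxV mul1mx.
transitivity (y 0); first by rewrite /y expmx0 mul1mx.
apply/matrixP => i j.
have [||u _] := @MVT_segment R (fun u : R => y u i j) (fun=> 0) 0 t t0.
- by move=> u; rewrite in_itv/= => /andP[u0 _]; have := dy u u0 i j; rewrite mxE.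
- have yijc : {within `[0, +oo[, continuous (fun u : R => y u i j)}.
    by move=> u; have /cvg_mxP/(_ i j) := yc u.
  apply: continuous_subspaceW yijc.
  by move=> u /=; rewrite !in_itv/= => /andP[-> _].
- by rewrite mul0r => /eqP; rewrite subr_eq0 => /eqP.
Qed.

(** The identity [(r^T otimes M) vec X = M X r], with [vec] stacking the columns. *)
Lemma sync_trajectoryE (R : realType) n p (A : 'M[R]_n) (r : 'cV[R]_p)
    (x0 : 'I_p -> 'cV[R]_n) (t : R) :
  sync_trajectory A r x0 t = expmx (t *: A) *m (\matrix_(k, j) x0 j k 0 *m r).
Proof.
apply/matrixP => i j; rewrite ord1 /sync_trajectory castmxE.
have iE : (mxtens_unindex (cast_ord (esym (mul1n n)) i)).2 = i.
  by apply: val_inj; rewrite /= modn_small.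
rewrite !mxE (reindex (@mxtens_index p n)) /=; last first.
  by exists (@mxtens_unindex p n) => k _; [exact: mxtens_indexK|exact: mxtens_unindexK].
transitivity (\sum_(jk : 'I_p * 'I_n)
    r jk.1 0 * expmx (t *: A) i jk.2 * x0 jk.1 jk.2 0).
  by apply: eq_bigr => jk _; rewrite !mxE mxtens_indexK iE [in LHS]ord1.
rewrite -(pair_bigA _ (fun j k => r j 0 * expmx (t *: A) i k * x0 j k 0))/=.
rewrite exchange_big/=; apply: eq_bigr => k _.
by rewrite mxE mulr_sumr; apply: eq_bigr => l _; rewrite !mxE; ring.
Qed.

Lemma hurwitz_deflated_cvg0 (R : realType) n p (A N : 'M[R]_n) (Gamma : 'M[R]_p)
    (r : 'cV[R]_p) (X : R -> 'M[R]_(n, p)) :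
  connected_mx Gamma -> r^T *m Gamma = 0 -> r^T *m (const_mx 1 : 'cV[R]_p) = 1%:M ->
  (forall l : R[i], complex.Re l < 0 ->
    hurwitz (complexify A + l *: map_mx (real_complex R) N)) ->
  (forall t, 0 < t -> is_mx_derive X t (A *m X t + N *m X t *m Gamma^T)) ->
  X t - X t *m r *m (const_mx 1)^T @[t --> +oo] --> (0 : 'M[R]_(n, p)).
Proof.
move=> cG rG r1 hAN dX.
pose one := const_mx 1 : 'cV[R]_p.
have Gr : Gamma^T *m r = 0 by rewrite -[r]trmxK -trmx_mul rG trmx0.
have oneG : one^T *m Gamma^T = 0.
  have [_ G1 _] := cG; rewrite -trmx_mul -[RHS]trmx0; congr _^T.
  apply/matrixP => i j; rewrite !mxE -[RHS](G1 i).
  by apply: eq_bigr => k _; rewrite mxE mulr1.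
have oner : one^T *m r = 1%:M by rewrite -[r]trmxK -trmx_mul r1 trmx1.
pose D := 1%:M - r *m one^T.
pose G := (Gamma - one *m r^T)^T.
(* The projection [D] passes through the coupling: [X Gamma^T D = X Gamma^T = (X D) G], which closes
   the equation of [E = X D]. *)
have GD : Gamma^T *m D = Gamma^T by rewrite mulmxBr mulmx1 mulmxA Gr mul0mx subr0.
have DG : D *m G = Gamma^T.
  rewrite /D /G linearB/= trmx_mul trmxK mulmxBl mul1mx mulmxBr.
  rewrite -[_ *m Gamma^T]mulmxA oneG mulmx0 sub0r opprK.
  by rewrite -!mulmxA [one^T *m _]mulmxA oner mul1mx subrK.
pose E t := X t *m D.
have [cE _] : cmx_cvg0 (fun t => map_mx (real_complex R) (E t)).
  apply: (@coupled_decay _ _ _ (complexify A) (map_mx (real_complex R) N) (complexify G)).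
  - by move=> z /(hurwitz_deflated_laplacian cG rG r1); exact: hAN.
  - move=> t t0; rewrite -!map_mxM -map_mxD; split.
      rewrite mxRe_complexify.
      under [X in is_mx_derive X]eq_fun do rewrite mxRe_complexify.
      apply: is_mx_derive_eq; first exact: (is_mx_derive_mulmxr D (dX t t0)).
      by rewrite mulmxDl -!mulmxA DG GD.
    rewrite mxIm_complexify.
    under [X in is_mx_derive X]eq_fun do rewrite mxIm_complexify.
    exact: is_mx_derive_cst.
have EE t : E t = X t - X t *m r *m (const_mx 1)^T by rewrite /E mulmxBr mulmx1 mulmxA.
by move: cE; under eq_fun do rewrite mxRe_complexify EE.
Qed.

Lemma norm2_cvg0 (R : realType) n (v : R -> 'cV[R]_n) :
  v t @[t --> +oo] --> (0 : 'cV[R]_n) -> norm2 (v t) @[t --> +oo] --> (0 : R).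
Proof.
move=> /cvg_mxP v0; rewrite -[X in _ --> X]sqrtr0.
apply: (cvg_comp (fun t => \sum_(i < n) v t i 0 ^+ 2) (@Num.sqrt R)); last first.
  exact: sqrt_continuous.
have : \sum_(i < n) v t i 0 ^+ 2 @[t --> +oo] --> \sum_(i < n) (0 : R) ^+ 2.
  apply: cvg_big => [|i _]; first exact: add_continuous.
  by have := v0 i 0; rewrite mxE => c; apply: cvgM.
by rewrite big1// => i _; rewrite expr0n.
Qed.

Unset Implicit Arguments.
Set Strict Implicit.

Theorem theorem3 (R : realType) (m n : nat)
    (A : 'M[R]_n) (B : 'M[R]_(n, m)) (K : 'M[R]_(m, n))
    (hA : neutrally_stable A) (hAB : stabilizable A B) (hK : is_gain A B K)
    (p : nat) (hp : (1 <= p)%N)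
    (Gamma : 'M[R]_p) (hGamma : connected_mx Gamma)
    (r : 'cV[R]_p) (hr : r^T *m Gamma = 0)
    (hr1 : r^T *m (const_mx 1 : 'cV[R]_p) = 1%:M)
    (x0 : 'I_p -> 'cV[R]_n) (x : 'I_p -> R -> 'cV[R]_n)
    (hx : is_solution A B K Gamma x0 x) :
  synchronize x (sync_trajectory A r x0).
Proof.
pose X t : 'M[R]_(n, p) := \matrix_(k, j) x j t k 0.
have G1 i : \sum_j Gamma i j = 0 by have [_ /(_ i)] := hGamma.
have dX t : 0 < t -> is_mx_derive X t (A *m X t + B *m K *m X t *m Gamma^T).
  move=> t0 k i; have [_ _ /(_ t t0)/is_derive_mx/(_ k 0) d] := hx i.
  apply: is_derive_congr d _ _ => [s|]; first by rewrite mxE.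
  (* Zero row sums remove the [x_i] term, so the coupling is column [i] of [X Gamma^T]. *)
  have -> : coupling Gamma (x ^~ t) i = \sum_j Gamma i j *: x j t.
    rewrite /coupling; under eq_bigr do rewrite scalerBr.
    by rewrite sumrB -scaler_suml G1 scale0r subr0.
  have XG : \sum_j Gamma i j *: x j t = X t *m (row i Gamma)^T.
    apply/matrixP => a b; rewrite ord1 summxE mxE.
    by apply: eq_bigr => j _; rewrite !mxE mulrC.
  rewrite XG !mulmxA [LHS]mxE [RHS]mxE; congr (_ + _).
    by rewrite !mxE; apply: eq_bigr => l _; rewrite mxE.
  by rewrite mxE [RHS]mxE; apply: eq_bigr => l _; congr (_ * _); rewrite !mxE.
have Gr : Gamma^T *m r = 0 by rewrite -[r]trmxK -trmx_mul hr trmx0.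
(* [Gamma^T r = 0] removes the coupling from [X r], which therefore solves [s' = A s]. *)
have sE t : 0 <= t -> sync_trajectory A r x0 t = X t *m r.
  move=> t0; rewrite sync_trajectoryE.
  have -> : \matrix_(k, j) x0 j k 0 = X 0.
    by apply/matrixP => k j; rewrite !mxE; have [-> _ _] := hx j.
  apply/esym/(@expmx_unique _ _ _ (fun t => X t *m r)) => // [u|u u0].
    apply: cvg_mulmxr; apply/cvg_mxP => k j; rewrite mxE.
    have -> : (fun s => X s k j) = (fun s => x j s k 0).
      by apply/funext => s; rewrite mxE.
    have [_ /(_ u)/cvg_mxP c _] := hx j; exact: c.
  have := is_mx_derive_mulmxr r (dX u u0).
  by rewrite mulmxDl -!mulmxA Gr !mulmx0 addr0.
have E0 := hurwitz_deflated_cvg0 hGamma hr hr1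
  (fun l => @closed_loop_hurwitz R m n A B K l hA hAB hK) dX.
move=> i; apply: norm2_cvg0.
have : col i (X t - X t *m r *m (const_mx 1)^T) @[t --> +oo] --> (0 : 'cV[R]_n).
  move/cvg_mxP : E0 => E0; apply/cvg_mxP => k j; rewrite mxE.
  by under eq_fun do rewrite mxE; have := E0 k i; rewrite mxE.
(* The identification [sE] holds for [0 <= t], that is, eventually along the limit. *)
apply: cvg_trans; apply: near_eq_cvg; near=> t.
have t0 : 0 <= t by near: t; apply: nbhs_pinfty_ge; exact: num_real.
rewrite sE//; apply/matrixP => k j; rewrite ord1 !mxE; congr (_ - _).
by rewrite big_ord1 !mxE mulr1.
Unshelve. all: by end_near. Qed.
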